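(* Suppose $Z_1,\ldots,Z_n$ are mean zero random vectors in $\mathbb{R}^q$ with a causal representation $Z_i=G_i(\ldots,\varepsilon_{i-1},\varepsilon_i)$. Assume that for some $\alpha>0$ and $\nu>0$, $$\|\{Z\}\|_{\psi_\alpha,\nu}=\sup_{r\ge2}\sup_{m\ge0}r^{-1/\alpha}(m+1)^\nu\Delta_{m,r}\le K_{n,q}.$$ Define $$\Omega_n(\nu):=2^\nu\times\begin{cases}5/(\nu-1/2)^3,&\text{if }\nu>1/2,\\2(\log_2n)^{5/2},&\text{if }\nu=1/2,\\5(2n)^{1/2-\nu}/(1/2-\nu)^3,&\text{if }\nu<1/2.\end{cases}$$ Then for all $t\ge0$, with probability at least $1-8e^{-t}$, $$\max_{1\le j\le q}\left|\sum_{i=1}^nZ_i(j)\right|\le e\sqrt n\,\|\{Z\}\|_{2,\nu}B_\nu\sqrt{t+\log(q+1)}+C_\alpha K_{n,q}(\log n)^{1/s(\alpha)}\Omega_n(\nu)(t+\log(q+1))^{1/T_1(s(\alpha))}.$$ Here $B_\nu$ and $C_\alpha$ are constants depending only on $\nu$ and $\alpha$, respectively.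
   Context: $s(\lambda)=(1/2+1/\lambda)^{-1}$ and $T_1(\lambda)=\min\{\lambda,1\}$ for $\lambda>0$. Let $\{\varepsilon_i,\varepsilon_i':i\in\mathbb{Z}\}$ be i.i.d. random elements of a measurable space. A process $W_i=G_i(\ldots,\varepsilon_{i-1},\varepsilon_i)\in\mathbb{R}^q$, $1\le i\le n$, with $G_i=(g_{i1},\ldots,g_{iq})$, is said to have a causal representation. For $s\ge0$, let $W_{i,s}(j)=g_{ij}(\ldots,\varepsilon_{i-s-1},\varepsilon_{i-s}',\varepsilon_{i-s+1},\ldots,\varepsilon_i)$, i.e. $\varepsilon_{i-s}$ is replaced by $\varepsilon'_{i-s}$. With $\|V\|_r=(\mathbb{E}|V|^r)^{1/r}$, for $r\ge1$ define $\delta_{s,r,j}=\max_{1\le i\le n}\|W_i(j)-W_{i,s}(j)\|_r$, $\Delta_{m,r,j}=\sum_{s=m}^\infty\delta_{s,r,j}$, $\Delta_{m,r}=\max_{1\le j\le q}\Delta_{m,r,j}$, $\|\{W(j)\}\|_{r,\nu}=\sup_{m\ge0}(m+1)^\nu\Delta_{m,r,j}$, $\|\{W\}\|_{r,\nu}=\max_{1\le j\le q}\|\{W(j)\}\|_{r,\nu}$, and $\|\{W\}\|_{\psi_\alpha,\nu}=\sup_{r\ge2}r^{-1/\alpha}\|\{W\}\|_{r,\nu}$.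
   Formalization: The theorem is stated for n ≥ 2; at n = 1 the factor (log n)^{1/s(α)} vanishes and the claimed bound, resting on second moments only, is false. *)

(* Defs.v *)
(* MathComp-Analysis *)
From HB Require Import structures.
From mathcomp Require Import all_boot all_order all_algebra finmap.
From mathcomp Require Import all_classical all_reals all_analysis.

Set Implicit Arguments.
Unset Strict Implicit.
Unset Printing Implicit Defensive.

Import Order.TTheory GRing.Theory Num.Theory.
Import numFieldNormedType.Exports.

Local Open Scope classical_set_scope.
Local Open Scope ring_scope.

Section iid.
Local Open Scope ereal_scope.
Context d d' (T : measurableType d) (S : measurableType d') (R : realType).
Variables (P : probability T R) (I : choiceType) (X : I -> {RV P >-> S}).

Definition mutually_independent : Prop :=
  forall (J : {fset I}) (A : I -> set S), (forall i, measurable (A i)) ->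
    P (\bigcap_(i in [set` J]) (X i @^-1` A i)) =
    \big[mule/1]_(i <- J) P (X i @^-1` A i).

Definition identically_distributed : Prop :=
  forall (i j : I) (A : set S), measurable A ->
    distribution P (X i) A = distribution P (X j) A.

Definition iid : Prop := mutually_independent /\ identically_distributed.

End iid.

(* The family {eps_i, eps'_i : i in Z}, indexed by two disjoint copies of Z. *)
Definition innovations d d' (T : measurableType d) (S : measurableType d')
    (R : realType) (P : probability T R) (eps eps' : int -> {RV P >-> S})
    (k : (int + int)%type) : {RV P >-> S} :=
  match k with inl i => eps i | inr i => eps' i end.

(* A sequence x : nat -> S stands for a one-sided past read backwards in time:
   x k is the value at lag k, so (..., eps_(i-1), eps_i) is the sequence
   k |-> eps_(i-k). Pasts carry the product sigma-algebra. *)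
Definition cylinders d (S : measurableType d) : set (set (nat -> S)) :=
  \bigcup_k preimage_set_system setT (fun x : nat -> S => x k) measurable.

Definition pasts d (S : measurableType d) := g_sigma_algebraType (@cylinders d S).

Section causal_process.
Context d d' (T : measurableType d) (S : measurableType d') (R : realType).
Variables (P : probability T R) (eps eps' : int -> {RV P >-> S}).
(* Only the times 1 <= i <= n of the process are ever used. *)
Variables (n q : nat) (g : nat -> 'I_q -> {mfun pasts S >-> R}).

Definition past (i : int) (w : T) : nat -> S := fun k => eps (i - k%:Z) w.

(* eps_(i-s) is replaced by eps'_(i-s). *)
Definition coupled_past (i : int) (s : nat) (w : T) : nat -> S :=
  fun k => if k == s then eps' (i - s%:Z) w else eps (i - k%:Z) w.

Definition causal (i : nat) (j : 'I_q) (w : T) : R := g i j (past i%:Z w).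

Definition coupled (i s : nat) (j : 'I_q) (w : T) : R :=
  g i j (coupled_past i%:Z s w).

Local Open Scope ereal_scope.

(* All quantities below are nonnegative, possibly infinite; 0 is the neutral
   element of the finite maxima. coord_dep_norm r nu j is ||{W(j)}||_(r,nu),
   dep_norm r nu is ||{W}||_(r,nu), psi_dep_norm is ||{W}||_(psi_alpha,nu). *)
Definition delta (s : nat) (r : R) (j : 'I_q) : \bar R :=
  \big[maxe/0]_(1 <= i < n.+1)
    'N[P]_r%:E[EFin \o (fun w => causal i j w - coupled i s j w)%R].

Definition Delta (m : nat) (r : R) (j : 'I_q) : \bar R :=
  \sum_(m <= s <oo) delta s r j.

Definition coord_dep_norm (r nu : R) (j : 'I_q) : \bar R :=
  ereal_sup (range (fun m : nat => (m.+1%:R `^ nu)%:E * Delta m r j)).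

Definition dep_norm (r nu : R) : \bar R :=
  \big[maxe/0]_(j < q) coord_dep_norm r nu j.

Definition psi_dep_norm (alpha nu : R) : \bar R :=
  ereal_sup [set (r `^ (- alpha^-1))%:E * dep_norm r nu | r in [set r : R | (2 <= r)%R]].

End causal_process.

Section constants.
Context (R : realType).

Definition s_ (lambda : R) : R := (2^-1 + lambda^-1)^-1.

Definition T1 (lambda : R) : R := Num.min lambda 1.

Definition log2 (x : R) : R := ln x / ln 2.

Definition Omega (n : nat) (nu : R) : R :=
  2 `^ nu *
  (if 2^-1 < nu then 5 / (nu - 2^-1) ^+ 3
   else if nu == 2^-1 then 2 * log2 n%:R `^ (5 / 2)
   else 5 * (2 * n%:R) `^ (2^-1 - nu) / (2^-1 - nu) ^+ 3).

End constants.

(* Main.v *)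
Require Import Defs.
From HB Require Import structures.
From mathcomp Require Import all_boot all_order all_algebra finmap.
From mathcomp Require Import all_classical all_reals all_analysis.
From mathcomp Require Import measurable_realfun.
From mathcomp Require Import ring lra zify.

Set Implicit Arguments.
Unset Strict Implicit.
Unset Printing Implicit Defensive.

Import Order.TTheory GRing.Theory Num.Theory.
Import numFieldNormedType.Exports.

Local Open Scope classical_set_scope.
Local Open Scope ring_scope.

(** The theorem follows from a bound on the moments of one coordinate of the
    partial sum: for all integers [r >= 1], the L^(2r) norm of the sum is at
    most [moment_bound], of order
      sqrt(r n) ||Z||_(2,nu) + K (log n)^beta Omega_n(nu) r^max(beta,1)
    with [beta = 1/2 + 1/alpha = 1/s(alpha)] ([causal_sum_moment]).  Put
    [u = t + log (q + 1)] and choose [r] between [u/2] and [u].  Markov's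
    inequality then bounds by [exp (- 2 r) <= exp (- u)] the probability that
    a coordinate exceeds [e] times this norm ([moment_tail]), and the union
    over the [q] coordinates costs a factor that the [log (q + 1)] in [u] pays
    for.

    For the moment bound, time is reversed: the process at time [n - a] is a
    function [Y a] of the coordinates [a], [a+1], ... of the sequence of
    independent, identically distributed eps_n, eps_(n-1), ...  For such a law
    the conditional expectation given the coordinates in [A] has an explicit
    version, [condE A f x]: keep the coordinates of [x] in [A] and integrate
    over an independent copy of the others.  The tower rule, independence and
    the comparison with the coupled process are then instances of Fubini's
    theorem, the tower rule even at every point.  Let [local a m] be the expectation of
    [Y a] given [m] coordinates, [a] to [a + m - 1].
    - The increment [innov s a = local a s.+1 - local a s] has L^(2k) norm at
      most delta_(s,2k), and for a fixed lag [s] these increments form a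
      martingale difference sequence in [a].  A sum of [N] of them thus has
      L^(2k) norm at most sqrt(4 k N) delta_(s,2k) ([martingale_step],
      [innov_sum_moment]).
    - The increments with lags between 2^(l-1) and 2^l are summed to
      [level l a], and over blocks of length 2^l in [a].  Blocks of the same
      parity depend on disjoint sets of coordinates, hence are independent.
      Their 2p-th norm grows like p^beta, the factor sqrt p coming from the
      martingale bound and p^(1/alpha) from the hypothesis, so that the
      Rosenthal inequality [rosenthal_weibull] applies.
    - For the lags from about [n] on, the martingale bound is enough.
    - Over the levels, the Gaussian terms add up to a multiple of the sum of
      the 2^(- l nu), which is the constant depending on [nu], and the Weibull
      terms to a multiple of the sum of the 2^(l (1/2 - nu)) for 2^l <= n,
      which is at most a multiple of Omega_n(nu) ([geometric_sum_Omega]).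

    All of this is done for bounded functions.  The limit in which [local a m]
    becomes [Y a] is Levy's upward theorem ([condE_below_cvg]), and unbounded
    functions are reached by truncation: clipping is 1-Lipschitz, so it does
    not increase the coupling distances, and Fatou's lemma gives the limit
    ([sum_moment]). *)

(** * Inequalities between powers *)

Ltac nonneg := repeat (first [ done | apply: ltW; done |
  lazymatch goal with
  | |- is_true (0 <= _ ^+ 2) => apply: sqr_ge0
  | |- is_true (0 <= _ ^+ (2 * _)) => rewrite exprM
  | |- is_true (0 <= _ ^+ _) => apply: exprn_ge0
  | |- is_true (0 <= _%:R) => apply: ler0n
  | |- is_true (0 <= _ + _) => apply: addr_ge0
  | |- is_true (0 <= _ * _) => apply: mulr_ge0
  | |- is_true (0 <= _^-1) => rewrite invr_ge0
  | |- is_true (0 <= `|_|) => apply: normr_ge0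
  | |- is_true (0 <= _ `^ _) => apply: powR_ge0
  | |- is_true (0 <= Num.sqrt _) => apply: sqrtr_ge0
  | |- is_true (0 <= expR _) => apply: expR_ge0
  | |- is_true (0 <= \sum_(_ <- _ | _) _) => apply: sumr_ge0 => ? _
  end ]).

Lemma eq_leW disp (T : porderType disp) (x y : T) : x = y -> (x <= y)%O.
Proof. by move->. Qed.

Section power_inequalities.
Context {R : realType}.
Implicit Types (x y z a b u v w : R) (k p : nat).

Lemma norm_even_exp x k : `|x| ^+ (2 * k) = x ^+ (2 * k).
Proof. by rewrite !exprM real_normK// num_real. Qed.

Lemma even_exp_ge0 x k : 0 <= x ^+ (2 * k).
Proof. by rewrite exprM exprn_ge0 ?sqr_ge0. Qed.

Lemma tangent_expn a b k : 0 <= a -> 0 <= b ->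
  b ^+ k.+1 + k.+1%:R * b ^+ k * (a - b) <= a ^+ k.+1.
Proof.
move=> a0 b0; elim: k => [|k IH]; first by rewrite !expr1 expr0; lra.
rewrite [leRHS]exprS; apply: le_trans (ler_wpM2l a0 IH).
rewrite -subr_ge0 [X in 0 <= X](_ : _ = k.+1%:R * b ^+ k * (a - b) ^+ 2).
  by nonneg.
by rewrite !exprS; ring.
Qed.

(** Convexity of even powers. It serves twice: for Jensen's inequality, and to
    replace the power of [x - y] by a linear lower bound in
    [martingale_step_expn]. *)
Lemma tangent_even_expn x z k :
  x ^+ (2 * k.+1) + (2 * k.+1)%:R * x ^+ (2 * k).+1 * (z - x) <= z ^+ (2 * k.+1).
Proof.
rewrite !exprM; apply: le_trans (tangent_expn k (sqr_ge0 z) (sqr_ge0 x)).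
rewrite lerD2l exprS exprM natrM.
have h : 0 <= x ^+ 2 ^+ k by nonneg.
rewrite -subr_ge0
 [X in 0 <= X](_ : _ = k.+1%:R * x ^+ 2 ^+ k * (z - x) ^+ 2); last by ring.
by nonneg.
Qed.

Lemma double_expn_le z w k : 0 <= z -> 0 <= w ->
  2 * (z + w) ^+ k - z ^+ k <= (z + 2 * w) ^+ k.
Proof.
move=> z0 w0; elim: k => [|k IH]; first by rewrite !expr0; lra.
have h : z ^+ k <= (z + 2 * w) ^+ k.
  by rewrite lerXn2r ?nnegrE//; lra.
have := ler_wpM2l (addr_ge0 z0 w0) IH.
have := ler_wpM2l w0 h.
by rewrite !exprS; lra.
Qed.

Lemma even_sum (F : nat -> R) k : (forall i, odd i -> F i = 0) ->
  \sum_(i < (2 * k).+1) F i = \sum_(j < k.+1) F (2 * j)%N.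
Proof.
move=> F0; elim: k => [|k IH]; first by rewrite muln0 !big_ord1 muln0.
rewrite [RHS]big_ord_recr/= -IH.
have -> : (2 * k.+1).+1 = (2 * k).+3 by lia.
rewrite 2!big_ord_recr/= -addrA; congr (_ + _).
rewrite F0 ?add0r; first by congr F; lia.
by rewrite /= mul2n odd_double.
Qed.

(** The ratio of the two binomials gains (2k - 2j - 1) / (2j + 1) <= 2k at each
    step in [j]. *)
Lemma bin_double_le k j : ('C(2 * k, 2 * j) <= 'C(k, j) * (2 * k) ^ j)%N.
Proof.
elim: j => [|j IH]; first by rewrite muln0 !bin0.
have e1 := mul_bin_left k j.
have e2 := mul_bin_left (2 * k) (2 * j).
have e3 := mul_bin_left (2 * k) (2 * j).+1.
have -> : (2 * j.+1 = (2 * j).+2)%N by lia.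
have [kj|jk] := leqP k j; first by rewrite bin_small//; lia.
suff : ((2 * j).+2 * (2 * j).+1 * 'C(2 * k, (2 * j).+2) <=
        (2 * j).+2 * (2 * j).+1 * ('C(k, j.+1) * (2 * k) ^ j.+1))%N.
  by rewrite leq_pmul2l// muln_gt0.
have -> : ((2 * j).+2 * (2 * j).+1 * 'C(2 * k, (2 * j).+2) =
  (2 * k - (2 * j).+1) * (2 * k - 2 * j) * 'C(2 * k, 2 * j))%N by nia.
rewrite expnS; move: ((2 * k) ^ j)%N IH => P IH.
have -> : ((2 * j).+2 * (2 * j).+1 * ('C(k, j.+1) * (2 * k * P)) =
  (2 * (2 * j).+1 * (2 * k) * (k - j)) * ('C(k, j) * P))%N.
  transitivity (2 * (2 * j).+1 * (2 * k) * P * (j.+1 * 'C(k, j.+1)))%N.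
    by have -> : ((2 * j).+2 = 2 * j.+1)%N; [lia|ring].
  by rewrite e1; ring.
apply: leq_mul; last exact: IH.
have -> : (2 * (2 * j).+1 * (2 * k) * (k - j) =
  ((2 * j).+1 * (2 * k)) * (2 * (k - j)))%N by ring.
apply: leq_mul; last by lia.
by apply: leq_trans (leq_subr _ _) _; rewrite mulSn leq_addr.
Qed.

(** Hypercontractivity of a random sign: the odd powers of [y] cancel, and the
    even ones are compared coefficient by coefficient. *)
Lemma two_point_expn x y k :
  (x + y) ^+ (2 * k) + (x - y) ^+ (2 * k) <= 2 * (x ^+ 2 + (2 * k)%:R * y ^+ 2) ^+ k.
Proof.
rewrite exprDn exprBn -big_split/=.
pose F i : R := x ^+ (2 * k - i) * y ^+ i *+ 'C(2 * k, i) +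
  (-1) ^+ i * x ^+ (2 * k - i) * y ^+ i *+ 'C(2 * k, i).
rewrite (_ : \sum_(i < _) _ = \sum_(i < (2 * k).+1) F i); last first.
  by apply: eq_bigr => i _.
rewrite even_sum; last first.
  by move=> i oi; rewrite /F -signr_odd oi expr1 mulN1r mulNr mulNrn subrr.
rewrite exprDn mulr_sumr; apply: ler_sum => j _.
rewrite /F -signr_odd (_ : odd (2 * j) = false) ?expr0 ?mul1r; last first.
  by rewrite mul2n odd_double.
rewrite -mulr2n -[leLHS]mulr_natl ler_wpM2l//.
rewrite -mulnBr.
rewrite !(exprM _ 2) (exprMn _ (2 * k)%:R) -natrX [leRHS](_ : _ =
  x ^+ 2 ^+ (k - j) * y ^+ 2 ^+ j * ('C(k, j) * (2 * k) ^ j)%:R); last first.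
  by rewrite natrM -[LHS]mulr_natr; ring.
rewrite -[leLHS]mulr_natr. apply: ler_wpM2l; first by nonneg.
by rewrite ler_nat bin_double_le.
Qed.

(** The pointwise form of the moment bound for martingales: the term linear in
    [y] is the one that has mean zero. It comes from adding the power of [x - y]
    to the left and bounding it below by its tangent at [x]. *)
Lemma martingale_step_expn x y k :
  (x + y) ^+ (2 * k.+1) <= (2 * k.+1)%:R * (x ^+ (2 * k).+1 * y)
    + (x ^+ 2 + (4 * k.+1)%:R * y ^+ 2) ^+ k.+1.
Proof.
have h1 := two_point_expn x y k.+1.
have h2 := tangent_even_expn x (x - y) k.
have h3 : 0 <= (2 * k.+1)%:R * y ^+ 2 by nonneg.
have h4 := double_expn_le k.+1 (sqr_ge0 x) h3.
have e : 2 * ((2 * k.+1)%:R * y ^+ 2) = (4 * k.+1)%:R * y ^+ 2 :> R.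
  by rewrite mulrA -natrM mulnA.
rewrite e in h4.
have e2 : x - y - x = - y by ring.
rewrite e2 in h2.
rewrite (exprM x) in h2.
by lra.
Qed.

(** Convexity of the power, scaled so that no division by [a + b] occurs. *)
Lemma convex_combination_expn a b u v p : 0 <= a -> 0 <= b -> 0 <= u -> 0 <= v ->
  (a * u + b * v) ^+ p.+1 <= (a + b) ^+ p * (a * u ^+ p.+1 + b * v ^+ p.+1).
Proof.
move=> a0 b0 u0 v0; elim: p => [|p IH]; first by rewrite !expr1 expr0 mul1r.
have c0 : 0 <= a * u + b * v by nonneg.
rewrite exprS; apply: (le_trans (ler_wpM2l c0 IH)).
rewrite [in leRHS]exprS mulrCA -[leRHS]mulrA [leRHS]mulrCA.
apply: ler_wpM2l; first by nonneg.
rewrite -subr_ge0 [X in 0 <= X](_ : _ =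
  a * b * ((u - v) * (u ^+ p.+1 - v ^+ p.+1))); last first.
  by rewrite !(exprS _ p.+1); ring.
apply: mulr_ge0; first by nonneg.
have [uv|vu] := leP u v.
  by rewrite mulr_le0// subr_le0// lerXn2r// nnegrE.
by rewrite mulr_ge0// subr_ge0; [exact: ltW|rewrite lerXn2r// ?nnegrE//; exact: ltW].
Qed.

End power_inequalities.

(** * Moments of bounded measurable functions *)

Section bounded_measurable.
Context {R : realType} d (T : measurableType d).
Implicit Types f g : T -> R.

(** Boundedness makes every mean below finite and every conditional expectation
    defined at all points. *)
Definition bdm f := measurable_fun setT f /\ exists M, forall x, `|f x| <= M.

Lemma bdm_cst (c : R) : bdm (fun=> c).
Proof. by split; [exact: measurable_cst|exists `|c|]. Qed.

Lemma bdmD f g : bdm f -> bdm g -> bdm (fun x => f x + g x).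
Proof.
move=> [mf [M fM]] [mg [N gN]]; split; first exact: measurable_funD.
by exists (M + N) => x; rewrite (le_trans (ler_normD _ _))// lerD.
Qed.

Lemma bdmM f g : bdm f -> bdm g -> bdm (fun x => f x * g x).
Proof.
move=> [mf [M fM]] [mg [N gN]]; split; first exact: measurable_funM.
by exists (M * N) => x; rewrite normrM ler_pM.
Qed.

Lemma bdmZ (c : R) f : bdm f -> bdm (fun x => c * f x).
Proof. exact/bdmM/bdm_cst. Qed.

Lemma bdmN f : bdm f -> bdm (fun x => - f x).
Proof.
move=> [mf [M fM]]; split; first exact: measurableT_comp.
by exists M => x; rewrite normrN.
Qed.

Lemma bdmB f g : bdm f -> bdm g -> bdm (fun x => f x - g x).
Proof. by move=> bf bg; apply: bdmD => //; exact: bdmN. Qed.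

Lemma bdmX p f : bdm f -> bdm (fun x => f x ^+ p).
Proof.
move=> bf; elim: p => [|p IH].
  by under [X in bdm X]eq_fun do rewrite expr0; exact: bdm_cst.
by under [X in bdm X]eq_fun do rewrite exprS; exact: bdmM.
Qed.

Lemma bdm_norm f : bdm f -> bdm (fun x => `|f x|).
Proof.
move=> [mf [M fM]]; split; first exact: measurableT_comp.
by exists M => x; rewrite normr_id.
Qed.

Lemma bdm_sum I (r : seq I) (Q : pred I) (F : I -> T -> R) :
  (forall i, Q i -> bdm (F i)) -> bdm (fun x => \sum_(i <- r | Q i) F i x).
Proof.
move=> bF; elim: r => [|i r IH].
  by under [X in bdm X]eq_fun do rewrite big_nil; exact: bdm_cst.
under [X in bdm X]eq_fun do rewrite big_cons.
by case: (boolP (Q i)) => // Qi; apply: bdmD => //; exact: bF.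
Qed.

End bounded_measurable.

Lemma bdm_comp {R : realType} d d' (T : measurableType d) (T' : measurableType d')
  (f : T' -> R) (h : T -> T') : bdm f -> measurable_fun setT h -> bdm (f \o h).
Proof.
move=> [mf [M fM]] mh; split; first exact: measurableT_comp.
by exists M => x; exact: fM.
Qed.

#[global] Hint Resolve bdm_cst : core.
Ltac bdm_tac := repeat (first [ assumption | exact: bdm_cst |
  lazymatch goal with
  | |- bdm (fun x => _ + _) => apply: bdmD
  | |- bdm (fun x => _ * _) => apply: bdmM
  | |- bdm (fun x => - _) => apply: bdmN
  | |- bdm (fun x => _ ^+ _) => apply: bdmX
  | |- bdm (fun x => `|_|) => apply: bdm_norm
  | |- bdm (fun x => \sum_(_ <- _ | _) _) => apply: bdm_sum => ? _
  end | solve [auto] ]).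

Section mean.
Context {R : realType} d (T : measurableType d) (P : probability T R).
Implicit Types f g : T -> R.

Definition mean f : R := \int[P]_x f x.

Lemma bdm_integrable f : bdm f -> P.-integrable setT (EFin \o f).
Proof.
move=> [mf [M fM]]; apply: measurable_bounded_integrable => //.
  by apply: (@le_lt_trans _ _ 1%E); rewrite ?ltry// probability_le1.
exists M; split; first exact: num_real.
by move=> N MN x _; apply: le_trans (ltW MN).
Qed.

Lemma mean_EFin f : bdm f -> (\int[P]_x (f x)%:E = (mean f)%:E)%E.
Proof.
by move=> bf; rewrite fineK//; apply: integrable_fin_num => //; exact: bdm_integrable.
Qed.

Lemma mean_cst (c : R) : mean (fun=> c) = c.
Proof.
rewrite /mean Rintegral_cst// -[RHS]mulr1; congr (_ * _).
by rewrite [X in fine X](_ : _ = 1%E)//; exact: probability_setT.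
Qed.

Lemma meanD f g : bdm f -> bdm g -> mean (fun x => f x + g x) = mean f + mean g.
Proof. by move=> bf bg; apply: RintegralD => //; exact: bdm_integrable. Qed.

Lemma meanB f g : bdm f -> bdm g -> mean (fun x => f x - g x) = mean f - mean g.
Proof. by move=> bf bg; apply: RintegralB => //; exact: bdm_integrable. Qed.

Lemma meanZ (c : R) f : bdm f -> mean (fun x => c * f x) = c * mean f.
Proof. by move=> bf; apply: RintegralZl => //; exact: bdm_integrable. Qed.

Lemma mean_le f g : bdm f -> bdm g -> (forall x, f x <= g x) -> mean f <= mean g.
Proof.
by move=> bf bg fg; apply: le_Rintegral => //; exact: bdm_integrable.
Qed.

Lemma mean_ge0 f : (forall x, 0 <= f x) -> 0 <= mean f.
Proof. by move=> f0; exact: Rintegral_ge0. Qed.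

Lemma mean_norm f : bdm f -> `|mean f| <= mean (fun x => `|f x|).
Proof. by move=> bf; apply: le_normr_Rintegral => //; exact: bdm_integrable. Qed.

Lemma mean_sum I (r : seq I) (F : I -> T -> R) : (forall i, bdm (F i)) ->
  mean (fun x => \sum_(i <- r) F i x) = \sum_(i <- r) mean (F i).
Proof.
move=> bF; elim: r => [|i r IH].
  by rewrite big_nil; under [X in mean X]eq_fun do rewrite big_nil; exact: mean_cst.
rewrite big_cons -IH -meanD//; last by bdm_tac.
by congr mean; apply: funext => x; rewrite big_cons.
Qed.

Lemma mean_bound f M : bdm f -> (forall x, `|f x| <= M) -> `|mean f| <= M.
Proof.
move=> bf fM; rewrite -(mean_cst M); apply: le_trans (mean_norm bf) _.
by apply: mean_le => //; exact: bdm_norm.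
Qed.

(** Jensen's inequality: integrate the tangent at the mean. *)
Lemma jensen_even f k : bdm f -> mean f ^+ (2 * k) <= mean (fun x => f x ^+ (2 * k)).
Proof.
move=> bf; case: k => [|k].
  by rewrite muln0 expr0; under [X in mean X]eq_fun do rewrite expr0; rewrite mean_cst.
set m := mean f.
suff <- : mean (fun x => m ^+ (2 * k.+1) +
    (2 * k.+1)%:R * m ^+ (2 * k).+1 * (f x - m)) = m ^+ (2 * k.+1).
  apply: mean_le => [||x]; [by bdm_tac..|exact: tangent_even_expn].
rewrite meanD; [|by bdm_tac..].
rewrite meanZ; last by bdm_tac.
by rewrite meanB; [rewrite !mean_cst subrr mulr0 addr0|bdm_tac..].
Qed.

(** The L^p norm of [f] is at most [a], with an integral exponent and without
    roots. *)
Definition Lp_le p f a := 0 <= a /\ mean (fun x => `|f x| ^+ p) <= a ^+ p.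

Lemma Lp_le_even k f a : 0 <= a -> mean (fun x => f x ^+ (2 * k)) <= a ^+ (2 * k) ->
  Lp_le (2 * k) f a.
Proof.
move=> a0 h; split => //.
by under [X in mean X]eq_fun do rewrite norm_even_exp.
Qed.

Lemma Lp_le_evenE k f a : Lp_le (2 * k) f a ->
  mean (fun x => f x ^+ (2 * k)) <= a ^+ (2 * k).
Proof.
by move=> [_]; under [X in mean X]eq_fun do rewrite norm_even_exp.
Qed.

Lemma Lp_le_trans p f a b : a <= b -> Lp_le p f a -> Lp_le p f b.
Proof.
move=> ab [a0 h]; split; first exact: le_trans ab.
by apply: le_trans h _; rewrite lerXn2r ?nnegrE// (le_trans a0).
Qed.

(** Bounds that degenerate when a norm vanishes are proved with some room and
    then closed. *)
Lemma Lp_le_closed p f a : 0 <= a ->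
  (forall e, 0 < e -> Lp_le p.+1 f (a + e)) -> Lp_le p.+1 f a.
Proof.
move=> a0 h; split => //.
set m := mean _.
have m0 : 0 <= m by apply: mean_ge0 => x; nonneg.
pose r := m `^ p.+1%:R^-1.
have r0 : 0 <= r by exact: powR_ge0.
have rE : r ^+ p.+1 = m.
  by rewrite -powR_mulrn// -powRrM mulVf ?powRr1// pnatr_eq0.
rewrite -rE; apply: lerXn2r; rewrite ?nnegrE//; apply/ler_addgt0Pr => e e0.
have [ae] := h e e0.
by rewrite -/m -rE ler_pXn2r ?nnegrE.
Qed.

(** Divide [f] by [a] and [g] by [b]: the sum is then [a + b] times a convex
    combination of functions of norm at most 1. *)
Lemma Lp_leD_pos p f g a b : bdm f -> bdm g -> 0 < a -> 0 < b ->
  Lp_le p.+1 f a -> Lp_le p.+1 g b -> Lp_le p.+1 (fun x => f x + g x) (a + b).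
Proof.
move=> bf bg a0 b0 [_ fa] [_ gb]; split; first by nonneg.
pose h x := (a + b) ^+ p * (a^-1 ^+ p * `|f x| ^+ p.+1 + b^-1 ^+ p * `|g x| ^+ p.+1).
apply: (@le_trans _ _ (mean h)).
  apply: mean_le => [||x]; [by bdm_tac|by rewrite /h; bdm_tac|].
  apply: le_trans (_ : (`|f x| + `|g x|) ^+ p.+1 <= _).
    by rewrite lerXn2r ?nnegrE ?ler_normD//; nonneg.
  have e (c u : R) : 0 < c -> c * (u / c) = u by move=> c0; field; exact: lt0r_neq0.
  rewrite -{1}(e a `|f x|)// -{1}(e b `|g x|)//.
  apply: le_trans (convex_combination_expn p _ _ _ _) _; [by nonneg..|].
  rewrite /h; apply: ler_wpM2l; first by nonneg.
  apply: eq_leW.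
  have e2 (c u : R) : 0 < c -> c * (u / c) ^+ p.+1 = c^-1 ^+ p * u ^+ p.+1.
    move=> c0; rewrite exprMn [X in _ * (_ * X)]exprS.
    by rewrite -[RHS]mul1r -(mulfV (lt0r_neq0 c0)); ring.
  by rewrite !e2.
have -> : mean h = (a + b) ^+ p * (a^-1 ^+ p * mean (fun x => `|f x| ^+ p.+1) +
    b^-1 ^+ p * mean (fun x => `|g x| ^+ p.+1)).
  by rewrite /h meanZ ?meanD ?meanZ//; bdm_tac.
rewrite [leRHS]exprSr; apply: ler_wpM2l; first by nonneg.
have e3 (c m : R) : 0 < c -> m <= c ^+ p.+1 -> c^-1 ^+ p * m <= c.
  move=> c0 mc; rewrite exprVn mulrC ler_pdivrMr ?exprn_gt0//.
  by rewrite -exprS.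
by apply: lerD; apply: e3.
Qed.

(** Minkowski's inequality; vanishing norms are approached from above. *)
Lemma Lp_leD p f g a b : bdm f -> bdm g ->
  Lp_le p.+1 f a -> Lp_le p.+1 g b -> Lp_le p.+1 (fun x => f x + g x) (a + b).
Proof.
move=> bf bg fa gb; have [a0 _] := fa; have [b0 _] := gb.
apply: Lp_le_closed => [|e e0]; first by nonneg.
rewrite (splitr e) addrACA; apply: Lp_leD_pos => //.
- by rewrite ltr_wpDl// divr_gt0.
- by rewrite ltr_wpDl// divr_gt0.
- by apply: Lp_le_trans fa; rewrite lerDl divr_ge0// ltW.
- by apply: Lp_le_trans gb; rewrite lerDl divr_ge0// ltW.
Qed.

Lemma Lp_leD_gt0 p f g a b : (0 < p)%N -> bdm f -> bdm g ->
  Lp_le p f a -> Lp_le p g b -> Lp_le p (fun x => f x + g x) (a + b).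
Proof. by case: p => // p _; exact: Lp_leD. Qed.

Lemma Lp_le0 p : Lp_le p.+1 (fun=> 0) 0.
Proof.
split => //; under [X in mean X]eq_fun do rewrite normr0 expr0n.
by rewrite mean_cst expr0n.
Qed.

Lemma Lp_le_sum p I (r : seq I) (F : I -> T -> R) (a : I -> R) :
  (forall i, bdm (F i)) -> (forall i, Lp_le p.+1 (F i) (a i)) ->
  Lp_le p.+1 (fun x => \sum_(i <- r) F i x) (\sum_(i <- r) a i).
Proof.
move=> bF h; elim: r => [|i r IH].
  by rewrite big_nil; under [X in Lp_le _ X]eq_fun do rewrite big_nil; exact: Lp_le0.
rewrite big_cons; under [X in Lp_le _ X]eq_fun do rewrite big_cons.
by apply: Lp_leD => //; bdm_tac.
Qed.

(** The L^(2k) norm of a martingale is controlled through Minkowski's inequality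
    in L^k for the squares, once the linear term has mean zero. *)
Lemma martingale_step k f g (a b : R) : bdm f -> bdm g -> 0 <= a -> 0 <= b ->
  mean (fun x => f x ^+ (2 * k).+1 * g x) = 0 ->
  mean (fun x => f x ^+ (2 * k.+1)) <= a ^+ k.+1 ->
  mean (fun x => g x ^+ (2 * k.+1)) <= b ^+ k.+1 ->
  mean (fun x => (f x + g x) ^+ (2 * k.+1)) <= (a + (4 * k.+1)%:R * b) ^+ k.+1.
Proof.
move=> bf bg a0 b0 orth fa gb.
pose c : R := (4 * k.+1)%:R.
have c0 : 0 <= c by nonneg.
have [_] : Lp_le k.+1 (fun x => f x ^+ 2 + c * g x ^+ 2) (a + c * b).
  apply: Lp_leD; [by bdm_tac..| |].
    split => //; apply: le_trans fa; apply: mean_le => [||x]; [by bdm_tac..|].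
    by rewrite ger0_norm ?sqr_ge0// exprM.
  split; first by nonneg.
  apply: (@le_trans _ _ (c ^+ k.+1 * mean (fun x => g x ^+ (2 * k.+1)))).
    rewrite -meanZ; last by bdm_tac.
    apply: mean_le => [||x]; [by bdm_tac..|].
    have h0 : 0 <= c * g x ^+ 2 by nonneg.
    by rewrite ger0_norm// (exprMn _ c) -exprM.
  by rewrite exprMn; apply: ler_wpM2l => //; nonneg.
apply: le_trans.
pose h x := (2 * k.+1)%:R * (f x ^+ (2 * k).+1 * g x)
    + (f x ^+ 2 + c * g x ^+ 2) ^+ k.+1.
apply: (@le_trans _ _ (mean h)).
  by apply: mean_le => [||x]; [by rewrite /h; bdm_tac..|exact: martingale_step_expn].
rewrite /h meanD; [|by bdm_tac..].
rewrite meanZ; last by bdm_tac.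
rewrite orth mulr0 add0r; apply: mean_le => [||x]; [by bdm_tac..|].
by rewrite ger0_norm//; nonneg.
Qed.

(** The squared norms of martingale differences add up, at the cost of a factor
    proportional to the exponent: Rio's inequality with a worse constant. *)
Lemma martingale_even_moment k (D : nat -> T -> R) (b : R) N : 0 <= b ->
  (forall i, bdm (D i)) ->
  (forall j, mean (fun x => (\sum_(0 <= i < j) D i x) ^+ (2 * k).+1 * D j x) = 0) ->
  (forall j, mean (fun x => D j x ^+ (2 * k.+1)) <= b ^+ k.+1) ->
  mean (fun x => (\sum_(0 <= i < N) D i x) ^+ (2 * k.+1)) <=
    (N%:R * (4 * k.+1)%:R * b) ^+ k.+1.
Proof.
move=> b0 bD orth Db; elim: N => [|N IH].
  under [X in mean X]eq_fun do rewrite big_nil expr0n.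
  by rewrite mean_cst !mul0r expr0n.
under [X in mean X]eq_fun do rewrite big_nat_recr//=.
rewrite -natr1 mulrDl mulrDl mul1r; apply: martingale_step => //.
- by bdm_tac.
- by nonneg.
Qed.

End mean.

(** * Conditional expectation by resampling *)

Section pasts_measurability.
Context d (S : measurableType d) d0 (T : measurableType d0).

Lemma measurable_coord k : measurable_fun setT (fun x : pasts S => x k).
Proof.
move=> _ B mB; rewrite setTI; apply: sub_sigma_algebra.
by exists k => //; exists B => //; rewrite setTI.
Qed.

Lemma measurable_pasts (f : T -> pasts S) :
  (forall k, measurable_fun setT (fun w => f w k)) -> measurable_fun setT f.
Proof.
move=> mf; apply: (@measurability _ _ T (pasts S) setT f (@cylinders d S)) => //.
move=> _ [B [k _ [C mC <-]] <-].
by have := mf k measurableT C mC; rewrite !setTI.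
Qed.

End pasts_measurability.

Section mixing.
Context d (S : measurableType d).
Implicit Types (A B : pred nat) (x y : pasts S).

Definition mix A x y : pasts S := fun k => if A k then x k else y k.

Lemma measurable_mix A :
  measurable_fun setT (fun z : pasts S * pasts S => mix A z.1 z.2).
Proof.
apply: measurable_pasts => k; rewrite /mix; case: (A k).
  exact: (measurableT_comp (@measurable_coord d S k) (@measurable_fst _ _ (pasts S) (pasts S))).
exact: (measurableT_comp (@measurable_coord d S k) (@measurable_snd _ _ (pasts S) (pasts S))).
Qed.

Lemma measurable_mixr A x : measurable_fun setT (mix A x).
Proof.
apply: measurable_pasts => k; rewrite /mix; case: (A k) => //.
exact: measurable_coord.
Qed.

Lemma mixC A x y : mix A x y = mix (predC A) y x.
Proof. by apply: funext => k; rewrite /mix /=; case: (A k). Qed.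

Lemma mix_mixl A x y z : mix A (mix A x z) y = mix A x y.
Proof. by apply: funext => k; rewrite /mix; case: (A k). Qed.

Lemma mix_mix A B x y z :
  mix B (mix A x y) z = mix (predI A B) x (mix B y z).
Proof. by apply: funext => k; rewrite /mix /=; case: (A k); case: (B k). Qed.

End mixing.

Section resampling.
Context {R : realType} d (S : measurableType d) (mu : probability (pasts S) R).
Implicit Types (A B : pred nat) (f g : pasts S -> R).
Notation mean := (mean mu).

(** The independence of the coordinates, in the form in which conditional
    expectations use it. *)
Definition resamplable := forall A (B : set (pasts S)), measurable B ->
  (mu \x mu)%E ((fun z => mix A z.1 z.2) @^-1` B) = mu B.

(** The conditional expectation of [f] given the coordinates in [A], for a law
    with independent coordinates. *)
Definition condE A f x := mean (fun y => f (mix A x y)).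

Lemma bdm_mixr A f x : bdm f -> bdm (fun y => f (mix A x y)).
Proof. by move=> bf; apply: (bdm_comp bf); exact: measurable_mixr. Qed.

Let bdm_mix A f : bdm f -> bdm (fun z : pasts S * pasts S => f (mix A z.1 z.2)).
Proof. by move=> bf; apply: (bdm_comp bf); exact: measurable_mix. Qed.

Let pair_integrable (F : pasts S * pasts S -> R) : bdm F ->
  ((mu \x mu)%E).-integrable setT (EFin \o F).
Proof.
move=> [mF [M FM]]; apply: measurable_bounded_integrable => //.
  rewrite -setXTT [ltLHS]product_measure1E//.
  by rewrite lte_mul_pinfty// ?ge0_fin_numE// (le_lt_trans (probability_le1 _ _))// ltry.
exists M; split; first exact: num_real.
by move=> N MN x _; apply: le_trans (ltW MN).
Qed.

Lemma bdm_pairr (F : pasts S * pasts S -> R) x : bdm F -> bdm (fun y => F (x, y)).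
Proof. by move=> bF; apply: (bdm_comp bF); exact: measurable_pair1. Qed.

Lemma bdm_mean_pair (F : pasts S * pasts S -> R) : bdm F ->
  bdm (fun x => mean (fun y => F (x, y))).
Proof.
move=> bF; have [mf [M fM]] := bF; split; last first.
  by exists M => x; apply: mean_bound => //; exact: bdm_pairr.
apply/measurable_EFinP.
have := measurable_fubini_F (pair_integrable bF).
congr measurable_fun; apply: funext => x.
by rewrite /fubini_F /= mean_EFin//; exact: bdm_pairr.
Qed.

Lemma bdm_condE A f : bdm f -> bdm (condE A f).
Proof. by move=> bf; exact: (bdm_mean_pair (bdm_mix A bf)). Qed.

Lemma mean_pair (F : pasts S * pasts S -> R) : bdm F ->
  mean (fun x => mean (fun y => F (x, y))) = fine (\int[(mu \x mu)%E]_z (F z)%:E).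
Proof.
move=> bF; rewrite /mean/= /Rintegral; congr fine.
rewrite -(integral12_prod_meas1 (pair_integrable bF)).
apply: eq_integral => x _; rewrite /fubini_F mean_EFin//.
exact: bdm_pairr.
Qed.

Lemma condEB A f g : bdm f -> bdm g ->
  condE A (fun x => f x - g x) = (fun x => condE A f x - condE A g x).
Proof.
by move=> bf bg; apply: funext => x; rewrite /condE meanB//; exact: bdm_mixr.
Qed.

Definition depends A f := forall x y, f (mix A x y) = f x.

Lemma depends_condE A f : depends A (condE A f).
Proof.
move=> x z; rewrite /condE; congr mean; apply: funext => y.
by rewrite mix_mixl.
Qed.

Lemma condE_id A f : depends A f -> condE A f = f.
Proof.
move=> dA; apply: funext => x; rewrite /condE.
by under [X in mean X]eq_fun do rewrite dA; exact: mean_cst.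
Qed.

(** Enlarging the set of kept coordinates is harmless, because [mix A x y] and
    [x] agree on [B] and so are not distinguished by [f]. *)
Lemma depends_sub A B f : (forall k, B k -> A k) -> depends B f -> depends A f.
Proof.
move=> BA dB x y; rewrite -(dB (mix A x y) x); congr f.
apply: funext => k; rewrite /mix; case: (boolP (B k)) => // Bk.
by rewrite BA.
Qed.

Lemma dependsC A f x y : depends (predC A) f -> f (mix A x y) = f y.
Proof. by move=> dA; rewrite mixC dA. Qed.

Lemma dependsB A f g : depends A f -> depends A g -> depends A (fun x => f x - g x).
Proof. by move=> df dg x y; rewrite df dg. Qed.

Lemma dependsX A f p : depends A f -> depends A (fun x => f x ^+ p).
Proof. by move=> df x y; rewrite df. Qed.

Lemma depends_sum_nat A m n (F : nat -> pasts S -> R) :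
  (forall i, (m <= i < n)%N -> depends A (F i)) ->
  depends A (fun x => \sum_(m <= i < n) F i x).
Proof. by move=> dF x y; apply: eq_big_nat => i /dF ->. Qed.

Hypothesis res : resamplable.

(** Fubini's theorem for two independent copies, followed by the invariance of
    the law. *)
Lemma mean_condE A f : bdm f -> mean (condE A f) = mean f.
Proof.
move=> bf; rewrite [LHS](mean_pair (bdm_mix A bf)) /mean /Rintegral; congr fine.
pose phi := fun z : pasts S * pasts S => mix A z.1 z.2.
have mphi : measurable_fun setT phi by exact: measurable_mix.
have mEf : measurable_fun setT (EFin \o f) by apply/measurable_EFinP; case: bf.
transitivity (\int[pushforward (mu \x mu)%E phi]_x (EFin \o f) x)%E.
  rewrite integral_pushforward//; first exact: (pair_integrable (bdm_mix A bf)).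
by apply: eq_measure_integral => B mB _; exact: res.
Qed.

(** Keeping [A] and then [B] resamples the complement of [B] once more; the two
    resamplings together are one, of the complement of the intersection. *)
Lemma condE_comp A B f : bdm f -> condE A (condE B f) = condE (predI A B) f.
Proof.
move=> bf; apply: funext => x; rewrite {1}/condE /(condE (predI A B)).
rewrite -[RHS](mean_condE B); last exact: bdm_mixr.
congr mean; apply: funext => y; rewrite /condE; congr mean; apply: funext => z.
by rewrite mix_mix.
Qed.

Lemma condE_compE C A B f : (forall k, A k && B k = C k) -> bdm f ->
  condE A (condE B f) = condE C f.
Proof.
move=> AB bf; rewrite condE_comp//.
have -> : C = (fun k => A k && B k) by apply: funext => k; rewrite AB.
by [].
Qed.

Lemma condE_mull A f g : bdm g -> depends A f ->
  condE A (fun x => f x * g x) = (fun x => f x * condE A g x).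
Proof.
move=> bg df; apply: funext => x; rewrite /condE -meanZ; last exact: bdm_mixr.
by congr mean; apply: funext => y; rewrite df.
Qed.

(** The orthogonality behind all martingale arguments below. *)
Lemma mean_mull0 A f g : bdm f -> bdm g -> depends A f ->
  condE A g = (fun=> 0) -> mean (fun x => f x * g x) = 0.
Proof.
move=> bf bg df g0; rewrite -(mean_condE A); last by bdm_tac.
by rewrite condE_mull// g0; under [X in mean X]eq_fun do rewrite mulr0; exact: mean_cst.
Qed.

Lemma condE_independent A f : depends (predC A) f -> condE A f = (fun=> mean f).
Proof.
move=> df; apply: funext => x; rewrite /condE; congr mean; apply: funext => y.
exact: dependsC.
Qed.

Lemma mean_independent A B f g : bdm f -> bdm g -> depends A f -> depends B g ->
  (forall k, A k -> ~~ B k) -> mean (fun x => f x * g x) = mean f * mean g.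
Proof.
move=> bf bg df dg AB; rewrite -(mean_condE A); last by bdm_tac.
rewrite condE_mull// condE_independent.
  under [X in mean X]eq_fun do rewrite mulrC.
  by rewrite meanZ// mulrC.
by apply: depends_sub dg => k Bk; apply/negP => /AB; rewrite Bk.
Qed.

Lemma condE_even_le A f k : bdm f ->
  mean (fun x => condE A f x ^+ (2 * k)) <= mean (fun x => f x ^+ (2 * k)).
Proof.
move=> bf; rewrite -(mean_condE A (f := fun x => f x ^+ _)); last by bdm_tac.
apply: mean_le => [||x].
- by apply: bdmX; exact: bdm_condE.
- by apply: bdm_condE; exact: bdmX.
- by apply: (@jensen_even _ _ _ mu (fun y => f (mix A x y))); exact: bdm_mixr.
Qed.

(** [f - condE A f] is an average of differences of [f] at coupled points, so
    Jensen's inequality applies. *)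
Lemma coupling_even_le A f k : bdm f ->
  mean (fun x => (f x - condE A f x) ^+ (2 * k)) <=
  mean (fun x => mean (fun y => (f x - f (mix A x y)) ^+ (2 * k))).
Proof.
move=> bf; pose F (z : pasts S * pasts S) := (f z.1 - f (mix A z.1 z.2)) ^+ (2 * k).
have bF : bdm F.
  apply/bdmX/bdmB; last exact: bdm_mix.
  by apply: (bdm_comp bf); exact: measurable_fst.
apply: mean_le => [||x].
- by apply: bdmX; apply: bdmB => //; exact: bdm_condE.
- exact: bdm_mean_pair bF.
- have bx := bdm_mixr A x bf.
  rewrite (_ : f x - condE A f x = mean (fun y => f x - f (mix A x y))).
    by apply: jensen_even; bdm_tac.
  by rewrite meanB// mean_cst.
Qed.

End resampling.

(** * A Rosenthal inequality for Weibull-type moments *)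

Section rosenthal_numerics.
Context {R : realType}.
Implicit Types (x M t beta : R).

(** A moment of any order [j >= 2] is controlled by the second moment on
    [|x| <= M] and by a moment of higher even order beyond. The order [p] and
    the level [M] are free, and are later chosen depending on [j]. *)
Lemma norm_exp_interpolation x M j p : 0 < M -> (2 <= j)%N -> (j <= 2 * p)%N ->
  `|x| ^+ j <= x ^+ 2 * M ^+ (j - 2) + x ^+ (2 * p) * M ^+ j / M ^+ (2 * p).
Proof.
move=> M0 j2 jp; have M1 : 0 <= M by exact: ltW.
rewrite -(real_normK (num_real x)) -(norm_even_exp x p); set y := `|x|.
have y0 : 0 <= y by exact: normr_ge0.
have [yM|My] := leP y M.
  rewrite -{1}(subnKC j2) exprD; apply: ler_wpDr; first by nonneg.
  apply: ler_wpM2l; first by nonneg.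
  by apply: lerXn2r; rewrite ?nnegrE.
apply: ler_wpDl; first by nonneg.
rewrite ler_pdivlMr ?exprn_gt0// -(subnKC jp) !exprD -mulrA.
apply: ler_wpM2l; first by nonneg.
rewrite mulrC; apply: ler_wpM2r; first by nonneg.
by apply: lerXn2r; rewrite ?nnegrE// ltW.
Qed.

Lemma geometric_half_le n : \sum_(i < n) (2^-1 : R) ^+ i <= 2.
Proof.
suff -> : \sum_(i < n) (2^-1 : R) ^+ i = 2 - 2 * 2^-1 ^+ n.
  by rewrite lerBlDr lerDl; nonneg.
elim: n => [|n IH]; first by rewrite big_ord0 expr0; lra.
by rewrite big_ord_recr/= IH exprS; lra.
Qed.

(** From [i ^ i / i! <= exp i], one term of the exponential series. *)
Lemma bin_le_expn n i : (0 < i)%N -> ('C(n, i)%:R : R) <= (expR 1 * n%:R / i%:R) ^+ i.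
Proof.
move=> i0.
have i0' : 0 < i%:R :> R by rewrite ltr0n.
have f0 : 0 < (i`!)%:R :> R by rewrite ltr0n fact_gt0.
have h1 : (i%:R : R) ^+ i <= expR 1 ^+ i * (i`!)%:R.
  rewrite -expRM_natl mulr1 -ler_pdivrMr//.
  case: i i0 i0' f0 => // i _ i0 f0.
  by apply: le_trans (expR_ge1Dxn i (ltW i0)); rewrite lerDr.
have h2 : ('C(n, i)%:R : R) * (i`!)%:R <= n%:R ^+ i.
  rewrite -natrM bin_ffact -natrX ler_nat.
  elim: (i) => [|k IH]; first by rewrite ffactn0 expn0.
  by rewrite ffactnSr expnSr leq_mul// leq_subr.
rewrite expr_div_n ler_pdivlMr ?exprn_gt0// exprMn.
rewrite (le_trans (ler_wpM2l _ h1))//.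
rewrite mulrCA; apply: ler_wpM2l => //; nonneg.
Qed.

Lemma powR_nat_ge1 (n : nat) beta : 0 <= beta -> (0 < n)%N -> 1 <= n%:R `^ beta.
Proof.
move=> b0 n0; have n1 : 1 <= n%:R :> R by rewrite ler1n.
by have := ler_powR n1 b0; rewrite powRr0.
Qed.

(** The factor [r / i] comes from the binomial coefficient and [maxn i q ^ beta]
    from the [maxn i q]-th norm of a summand. When [i <= q] the power of [q]
    dominates; when [i > q] the product is [r * i ^ (beta - 1)], which is largest
    at [i = 2 r] or at [i = 1] according to the sign of [beta - 1]. *)
Lemma rosenthal_scale beta (r q i : nat) : 0 <= beta -> (0 < r)%N -> (0 < q)%N ->
  (0 < i)%N -> (i <= 2 * r)%N ->
  r%:R / i%:R * (maxn i q)%:R `^ beta <=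
    2 `^ beta * q%:R `^ beta * r%:R `^ (Num.max beta 1).
Proof.
move=> b0 r0 q0 i0 ir.
have r1 : 1 <= r%:R :> R by rewrite ler1n.
have i1 : 1 <= i%:R :> R by rewrite ler1n.
have ip : 0 < i%:R :> R by rewrite ltr0n.
have q1 := powR_nat_ge1 b0 q0.
have t1 : 1 <= 2 `^ beta :> R by exact: (@powR_nat_ge1 2).
have rmax : r%:R <= r%:R `^ (Num.max beta 1) :> R.
  have m1 : 1 <= Num.max beta 1 by rewrite le_max lexx orbT.
  by have := ler_powR r1 m1; rewrite powRr1.
have [iq|qi] := leqP i q.
  rewrite mulrC -mulrA [leRHS]mulrCA; apply: ler_wpM2l; first by nonneg.
  apply: (@le_trans _ _ r%:R).
    by rewrite ler_pdivrMr// ler_peMr.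
  by apply: le_trans rmax _; rewrite ler_peMl.
rewrite [leRHS]mulrAC; apply: (@le_trans _ _ (2 `^ beta * r%:R `^ Num.max beta 1)); last first.
  by rewrite ler_peMr//; nonneg.
have [b1|b1] := leP 1 beta; last first.
  rewrite powRr1//; apply: (@le_trans _ _ r%:R); last by rewrite ler_peMl.
  rewrite mulrAC ler_pdivrMr//; apply: ler_wpM2l => //.
  by have := ler_powR i1 (ltW b1); rewrite powRr1.
rewrite -powRM//.
have e (x : R) : 0 < x -> x `^ beta = x `^ (beta - 1) * x.
  move=> x0; rewrite -{3}(@powRr1 _ x) ?ltW// -powRD; first by rewrite subrK.
  by rewrite (gt_eqF x0) implybT.
rewrite e// mulrCA divfK ?gt_eqF// [leRHS]e ?mulr_gt0 ?ltr0n//.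
apply: ler_pM; [by nonneg|by nonneg| |].
  apply: ge0_ler_powR; rewrite ?nnegrE ?subr_ge0//.
  by rewrite -natrM ler_nat.
by rewrite ler_peMl// ler1n.
Qed.

End rosenthal_numerics.

Section rosenthal.
Context {R : realType} d (T : measurableType d) (P : probability T R).
Notation mean := (mean P).
Variable X : nat -> T -> R.
Hypothesis bX : forall i, bdm (X i).
Hypothesis indep : forall j a b,
  mean (fun x => (\sum_(0 <= i < j) X i x) ^+ a * X j x ^+ b) =
  mean (fun x => (\sum_(0 <= i < j) X i x) ^+ a) * mean (fun x => X j x ^+ b).

(** Expanding the power of [S + X] by the binomial formula, and bounding the
    moments of [S] by induction, each summand multiplies the bound by
    [A] because 'C(p, i) <= 'C(n, i). All orders [p <= n] are handled with the
    same [t] and [A]. *)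
Lemma independent_sum_moment (t A : R) n : 0 < t -> 0 <= A ->
  (forall j, \sum_(i < n.+1) 'C(n, i)%:R * `|mean (fun x => X j x ^+ i)| / t ^+ i <= A) ->
  forall N p, (p <= n)%N ->
  `|mean (fun x => (\sum_(0 <= i < N) X i x) ^+ p)| <= t ^+ p * A ^+ N.
Proof.
move=> t0 A0 hA; elim=> [|N IH] p pn.
  under [X in mean X]eq_fun do rewrite big_nil expr0n.
  by rewrite mean_cst expr0 mulr1; case: p pn => [|p] _;
    rewrite ?normr1 ?expr0// normr0; nonneg; exact: ltW.
have bS : bdm (fun x => \sum_(0 <= i < N) X i x) by bdm_tac.
have -> : mean (fun x => (\sum_(0 <= i < N.+1) X i x) ^+ p) =
    \sum_(i < p.+1) 'C(p, i)%:R * (mean (fun x => (\sum_(0 <= i < N) X i x) ^+ (p - i)) *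
      mean (fun x => X N x ^+ i)).
  under [X in mean X]eq_fun do rewrite big_nat_recr//= exprDn.
  rewrite (@mean_sum _ _ _ P _ _ (fun (i : 'I_p.+1) x =>
      (\sum_(0 <= i < N) X i x) ^+ (p - i) * X N x ^+ i *+ 'C(p, i))).
    apply: eq_bigr => i _; rewrite -indep -meanZ; last by bdm_tac.
    by congr mean; apply: funext => x; rewrite mulr_natl.
  move=> i; rewrite (_ : (fun x => _) = fun x =>
      'C(p, i)%:R * ((\sum_(0 <= i < N) X i x) ^+ (p - i) * X N x ^+ i)).
    by bdm_tac.
  by apply: funext => x; rewrite mulr_natl.
apply: le_trans (ler_norm_sum _ _ _) _.
rewrite exprS mulrCA; apply: (@le_trans _ _ ((\sum_(i < n.+1)
  'C(n, i)%:R * `|mean (fun x => X N x ^+ i)| / t ^+ i) * (t ^+ p * A ^+ N))); last first.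
  by apply: ler_wpM2r; [nonneg|exact: hA].
rewrite mulr_suml.
pose F i := 'C(n, i)%:R * `|mean (fun x => X N x ^+ i)| / t ^+ i * (t ^+ p * A ^+ N).
have F0 i : 0 <= F i by rewrite /F; nonneg.
rewrite (big_ord_widen_leq n.+1) ?ltnS//.
rewrite [leRHS](bigID (fun i : 'I_n.+1 => (i < p.+1)%N))/=.
apply: ler_wpDr; first by apply: sumr_ge0 => i _; exact: F0.
apply: ler_sum => i ip; rewrite inordK// !normrM.
have := IH (p - i)%N (leq_trans (leq_subr _ _) pn).
set u := `|mean (fun x => (\sum_(_ <= _ < N) _) ^+ _)| => hu.
rewrite -[leRHS]/(F i).
have -> : F i = 'C(n, i)%:R * (t ^+ (p - i) * A ^+ N * `|mean (fun x => X N x ^+ i)|).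
  rewrite /F; rewrite -{1}(subnK (ip : (i <= p)%N)) exprD; field.
  by rewrite expf_neq0// gt_eqF.
rewrite ger0_norm//; apply: ler_pM;
  [by nonneg|by rewrite /u; nonneg|by rewrite ler_nat leq_bin2l|].
by apply: ler_wpM2r; first by nonneg.
Qed.

(** With [A = 1 + O(r / N)] in [independent_sum_moment], the factor [A ^+ N] is
    [exp (O(r))], a constant to the power [2 r]. That [A] can be so chosen is
    where the centering is used: the term of order 1 vanishes, the
    terms of order [i >= 2] have a Gaussian part, absorbed by the first summand
    of [t], and a part of size [1 / N] times a geometric series in [i], absorbed
    by the second. The integer [q] is of order [log N]. *)
Lemma rosenthal_weibull (beta L sigma : R) (N q r : nat) :
  0 <= beta -> 0 < L -> 0 <= sigma -> (0 < N)%N -> (0 < q)%N -> (0 < r)%N ->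
  N%:R <= expR q%:R :> R ->
  (forall j, mean (X j) = 0) ->
  (forall j, mean (fun x => X j x ^+ 2) <= sigma ^+ 2) ->
  (forall j p, (0 < p)%N ->
    mean (fun x => X j x ^+ (2 * p)) <= (L * p%:R `^ beta) ^+ (2 * p)) ->
  Lp_le P (2 * r) (fun x => \sum_(0 <= i < N) X i x)
    (expR 8 * (expR 1 * Num.sqrt (r%:R * N%:R) * sigma +
       4 * expR 1 ^+ 2 * 2 `^ beta * L * q%:R `^ beta * r%:R `^ Num.max beta 1)).
Proof.
move=> b0 L0 s0 N0 q0 r0 Nq mX vX wX.
have N0' : 0 < N%:R :> R by rewrite ltr0n.
have r0' : 0 < r%:R :> R by rewrite ltr0n.
have e0 : 0 < expR 1 :> R by exact: expR_gt0.
have L0' := ltW L0; have e0' := ltW e0; have N0'' := ltW N0'.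
pose E : R := expR 1.
set a := E * _ * sigma; set b := _ * r%:R `^ _; set t := a + b.
have a0 : 0 <= a by rewrite /a /E; nonneg.
have b0' : 0 < b by rewrite /b !mulr_gt0 ?powR_gt0 ?exprn_gt0 ?ltr0n ?expR_gt0.
have t0 : 0 < t by rewrite ltr_wpDl.
have t0' := ltW t0.
pose A : R := 1 + 16 * (r%:R / N%:R).
have A0 : 0 <= A by rewrite /A; nonneg.
have key j : \sum_(i < (2 * r).+1)
    'C(2 * r, i)%:R * `|mean (fun x => X j x ^+ i)| / t ^+ i <= A.
  pose c := r%:R / N%:R : R.
  have c0 : 0 <= c by rewrite /c; nonneg.
  apply: (@le_trans _ _ (\sum_(i < (2 * r).+1) ((i == 0)%:R + 8 * c * 2^-1 ^+ i))).
    apply: ler_sum => i _; case: i => i /= ir.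
    case: i ir => [|[|i]] ir.
    - rewrite bin0 !expr0; under [X in mean X]eq_fun do rewrite expr0.
      by rewrite mean_cst normr1 divr1 mulr1 lerDl; nonneg.
    - by rewrite mX normr0 mulr0 mul0r; nonneg.
    rewrite add0r; set j' := i.+2.
    have j2 : (2 <= j')%N by [].
    have j0 : (0 < j')%N by [].
    have j0' : 0 < j'%:R :> R by rewrite ltr0n.
    (* At order [2 p] with [p >= q], the excess over [M] is at most
       [exp (- 2 p) <= 1 / N]. *)
    pose p := maxn j' q.
    have p0 : (0 < p)%N by rewrite /p leq_max j0.
    have jp : (j' <= 2 * p)%N by rewrite (leq_trans (leq_maxl _ q))// leq_pmull.
    pose M := E * L * p%:R `^ beta.
    have M0 : 0 < M by rewrite /M !mulr_gt0 ?powR_gt0 ?ltr0n.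
    have M0' := ltW M0.
    have m1 : `|mean (fun x => X j x ^+ j')| <= sigma ^+ 2 * M ^+ (j' - 2) + M ^+ j' / N%:R.
      apply: le_trans (mean_norm P _) _; first by bdm_tac.
      pose h x := M ^+ (j' - 2) * X j x ^+ 2 + M ^+ j' / M ^+ (2 * p) * X j x ^+ (2 * p).
      apply: (@le_trans _ _ (mean h)).
        apply: mean_le => [||x]; [by bdm_tac|by rewrite /h; bdm_tac|].
        rewrite normrX; apply: le_trans (norm_exp_interpolation (X j x) M0 j2 jp) _.
        by rewrite /h; apply: eq_leW; ring.
      rewrite /h meanD ?meanZ; [|by bdm_tac..].
      apply: lerD; first by rewrite mulrC; apply: ler_wpM2r; [nonneg|exact: vX].
      rewrite -mulrA; apply: ler_wpM2l; first by nonneg.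
      rewrite ler_pdivrMl ?exprn_gt0//; apply: le_trans (wX j p p0) _.
      rewrite /M -[E * L * _]mulrA (exprMn _ E) mulrAC; apply: ler_peMl; first by nonneg.
      rewrite ler_pdivlMr// mul1r; apply: le_trans Nq _.
      rewrite /E -expRM_natl mulr1 ler_expR ler_nat.
      by rewrite (leq_trans (leq_maxr j' q))// leq_pmull.
    pose B : R := E * (2 * r)%:R / j'%:R.
    have B0 : 0 <= B by rewrite /B /E; nonneg; exact: ltW.
    have BM : B * M <= t / 2.
      have -> : B * M = 2 * E ^+ 2 * L * (r%:R / j'%:R * p%:R `^ beta).
        by rewrite /B /M natrM; ring.
      have jr : (j' <= 2 * r)%N by rewrite -ltnS.
      have := rosenthal_scale b0 r0 q0 j0 jr.
      set u := _ / _ * _; set v := _ * _ => uv.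
      have -> : t = 2 * (2 * E ^+ 2 * L * v) + a by rewrite /t /b /v /E; ring.
      have h : 2 * E ^+ 2 * L * u <= 2 * E ^+ 2 * L * v.
        by apply: ler_wpM2l => //; rewrite /E; nonneg.
      by lra.
    have Br : B <= E * r%:R.
      have j2R : 2 <= j'%:R :> R by rewrite (ler_nat _ 2).
      rewrite /B natrM ler_pdivrMr// (_ : E * _ = E * r%:R * 2); last by ring.
      by apply: ler_wpM2l => //; rewrite /E; nonneg.
    have v1 : B ^+ 2 * sigma ^+ 2 / t ^+ 2 <= c.
      rewrite ler_pdivrMr ?exprn_gt0//.
      apply: (@le_trans _ _ (c * a ^+ 2)).
        have -> : c * a ^+ 2 = (E * r%:R) ^+ 2 * sigma ^+ 2.
          rewrite /a !exprMn sqr_sqrtr; last by nonneg.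
          by rewrite /c; field; rewrite gt_eqF.
        apply: ler_wpM2r; first by nonneg.
        by apply: lerXn2r; rewrite ?nnegrE// /E; nonneg.
      apply: ler_wpM2l => //; apply: lerXn2r; rewrite ?nnegrE//.
      by rewrite lerDl ltW.
    have BMt : B * M / t <= 2^-1 by rewrite ler_pdivrMr// [leRHS]mulrC.
    have BMt0 : 0 <= B * M / t by nonneg.
    apply: (@le_trans _ _ (B ^+ j' * (sigma ^+ 2 * M ^+ (j' - 2) + M ^+ j' / N%:R) / t ^+ j')).
      apply: ler_wpM2r; first by nonneg.
      apply: ler_pM => //; exact: bin_le_expn.
    have -> : B ^+ j' * (sigma ^+ 2 * M ^+ (j' - 2) + M ^+ j' / N%:R) / t ^+ j' =
        B ^+ 2 * sigma ^+ 2 / t ^+ 2 * (B * M / t) ^+ i + (B * M / t) ^+ j' / N%:R.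
      rewrite /j' !subSS subn0 !exprMn !exprVn !exprS; field.
      by rewrite !gt_eqF ?exprn_gt0.
    have hi : (B * M / t) ^+ i <= 2^-1 ^+ i by apply: lerXn2r; rewrite ?nnegrE.
    have hj : (B * M / t) ^+ j' <= 2^-1 ^+ j' by apply: lerXn2r; rewrite ?nnegrE.
    have -> : 8 * c * 2^-1 ^+ j' = c * 2^-1 ^+ i + 4 * c * 2^-1 ^+ j' :> R.
      by rewrite /j' !exprS; field.
    apply: lerD.
      by apply: ler_pM => //; nonneg.
    rewrite mulrC; apply: ler_pM => //; first by nonneg.
    rewrite /c mulrA -[leLHS]mul1r; apply: ler_wpM2r; first by nonneg.
    by rewrite -natrM ler1n muln_gt0.
  rewrite big_split/= -mulr_sumr; apply: lerD.
    rewrite big_ord_recl/= big1 ?addr0// => i _.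
  have := ler_wpM2l (_ : 0 <= 8 * c) (geometric_half_le (2 * r).+1).
  rewrite /c; set u := \sum_(_ < _) _ => /(_ _)/le_trans; apply; first by nonneg.
  by apply: eq_leW; ring.
apply: Lp_le_even; first by apply: mulr_ge0 => //; nonneg.
have := independent_sum_moment t0 A0 key N (leqnn _).
move=> /(le_trans (ler_norm _))/le_trans; apply.
rewrite mulrC exprMn; apply: ler_wpM2r; first by nonneg.
apply: (@le_trans _ _ (expR (16 * (r%:R / N%:R)) ^+ N)).
  by apply: lerXn2r; rewrite ?nnegrE ?expR_ge1Dx//; nonneg.
rewrite -!expRM_natl ler_expR natrM.
apply: eq_leW; field.
by rewrite gt_eqF.
Qed.

End rosenthal.

(** * Dyadic decomposition of a sum of functions of the past *)

Section dyadic_levels.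
Context {R : realType} d (S : measurableType d) (mu : probability (pasts S) R).
Hypothesis res : resamplable mu.
Notation mean := (mean mu).
Notation condE := (condE mu).
Variable Y : nat -> pasts S -> R.
Hypothesis bY : forall a, bdm (Y a).
Hypothesis mY : forall a, mean (Y a) = 0.
Variable delta : nat -> nat -> R.
Hypothesis delta0 : forall k s, 0 <= delta k s.
Hypothesis Ydelta : forall k a s, (0 < k)%N ->
  mean (fun x => (Y a x - condE (predC1 (a + s)%N) (Y a) x) ^+ (2 * k)) <=
    delta k s ^+ (2 * k).

Definition window a m : pred nat := fun k => (a <= k < a + m)%N.
Definition local a m : pasts S -> R := condE (window a m) (Y a).
Definition innov s a x : R := local a s.+1 x - local a s x.

Lemma bdm_local a m : bdm (local a m).
Proof. exact: bdm_condE. Qed.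
Hint Resolve bdm_local : core.

Lemma bdm_innov s a : bdm (innov s a).
Proof. exact: bdmB. Qed.
Hint Resolve bdm_innov : core.

Lemma local0 a : local a 0 = (fun=> 0).
Proof.
rewrite /local condE_independent ?mY// => x y; congr (Y a); apply: funext => k.
by rewrite /mix /window /=; case: ifP => //; lia.
Qed.

Lemma depends_local a m : depends (window a m) (local a m).
Proof. exact: depends_condE. Qed.

(** Conditioning on the window with and without the coordinate [a + s]
    differs by first averaging out that coordinate. This identifies the
    increment as a conditional expectation of a coupling difference. *)
Lemma innovE s a : innov s a =
  condE (window a s.+1) (fun x => Y a x - condE (predC1 (a + s)%N) (Y a) x).
Proof.
rewrite condEB//; last exact: bdm_condE.
apply: funext => x; rewrite /innov /local.
rewrite (@condE_compE _ _ _ _ res (window a s))// => k.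
by rewrite /window /=; lia.
Qed.

Lemma innov_moment s a k : (0 < k)%N ->
  mean (fun x => innov s a x ^+ (2 * k)) <= delta k s ^+ (2 * k).
Proof.
move=> k0; rewrite innovE; apply: le_trans (Ydelta _ _ k0).
by apply: condE_even_le => //; apply: bdmB => //; exact: bdm_condE.
Qed.

(** Given the coordinates before [a + s], the two windows defining the increment
    reduce to the same one. *)
Lemma innov_orthogonal s a : condE (fun k => k < a + s)%N (innov s a) = (fun=> 0).
Proof.
rewrite condEB// /local.
rewrite (@condE_compE _ _ _ _ res (window a s))//; last by move=> k; rewrite /window; lia.
rewrite (@condE_compE _ _ _ _ res (window a s))//; last by move=> k; rewrite /window; lia.
by apply: funext => x; rewrite subrr.
Qed.

(** The increments at earlier indices only involve coordinates before [a + s]: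
    in reversed time, for a fixed lag, they are martingale differences. *)
Lemma innov_sum_moment s k a0 N : (0 < k)%N ->
  Lp_le mu (2 * k) (fun x => \sum_(0 <= i < N) innov s (a0 + i)%N x)
    (Num.sqrt (N%:R * (4 * k)%:R) * delta k s).
Proof.
case: k => // k _; apply: Lp_le_even; first by nonneg.
rewrite exprM [X in _ <= X ^+ _](_ : _ = N%:R * (4 * k.+1)%:R * delta k.+1 s ^+ 2);
  last by rewrite exprMn sqr_sqrtr//; nonneg.
apply: (@martingale_even_moment _ _ _ mu k (fun i => innov s (a0 + i)%N)) => //.
- by nonneg.
- move=> j; apply: (mean_mull0 res) (innov_orthogonal s (a0 + j)).
  + by bdm_tac.
  + by [].
  + apply/dependsX/depends_sum_nat => i ij.
    by apply: dependsB; apply: depends_sub (@depends_local _ _) => l;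
      rewrite /window; lia.
- by move=> j; rewrite -exprM; exact: innov_moment.
Qed.

Lemma local_increment a m m' x : (m <= m')%N ->
  local a m' x - local a m x = \sum_(m <= s < m') innov s a x.
Proof. by move=> mm'; rewrite /innov telescope_sumr. Qed.

Lemma block_moment k a0 N m m' : (0 < k)%N -> (m <= m')%N ->
  Lp_le mu (2 * k) (fun x => \sum_(0 <= i < N) (local (a0 + i) m' x - local (a0 + i) m x))
    (Num.sqrt (N%:R * (4 * k)%:R) * \sum_(m <= s < m') delta k s).
Proof.
move=> k0 mm'; rewrite mulr_sumr.
rewrite (_ : (fun x => _) = fun x => \sum_(m <= s < m') \sum_(0 <= i < N) innov s (a0 + i)%N x).
  case: k k0 => // k k0; apply: Lp_le_sum => s; first by bdm_tac.
  exact: innov_sum_moment.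
apply: funext => x; rewrite exchange_big/=; apply: eq_bigr => i _.
exact: local_increment.
Qed.

(** At [l = 0] the half is 0, so that level 0 is the increment of lag 0. *)
Definition level l a x : R := local a (2 ^ l) x - local a (2 ^ l)./2 x.

Lemma bdm_level l a : bdm (level l a).
Proof. exact: bdmB. Qed.
Hint Resolve bdm_level : core.

Lemma half_expn2_le l : ((2 ^ l)./2 <= 2 ^ l)%N.
Proof. by rewrite -{2}(odd_double_half (2 ^ l)) -addnn addnA leq_addl. Qed.

Lemma sum_levels L a x : \sum_(0 <= l < L.+1) level l a x = local a (2 ^ L) x.
Proof.
elim: L => [|L IH]; first by rewrite big_nat1 /level /= local0 subr0.
by rewrite big_nat_recr//= IH /level expnS mul2n doubleK addrC subrK.
Qed.

Definition level_block l (e b : nat) x : R :=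
  \sum_(0 <= i < 2 ^ l) level l ((2 * b + e) * 2 ^ l + i) x.

Lemma bdm_level_block l e b : bdm (level_block l e b).
Proof. by rewrite /level_block; bdm_tac. Qed.
Hint Resolve bdm_level_block : core.

(** A block of [2 ^ l] indices, each looking [2 ^ l] coordinates ahead, covers
    at most two blocks of coordinates; this is why blocks are taken by parity. *)
Lemma depends_level_block l e b :
  depends (fun k => (2 * b + e) * 2 ^ l <= k < (2 * b.+1 + e) * 2 ^ l)%N
    (level_block l e b).
Proof.
have h := half_expn2_le l.
apply: depends_sum_nat => i il; apply: dependsB;
  by apply: depends_sub (@depends_local _ _) => k; rewrite /window; nia.
Qed.

Lemma level_block_indep l e j a b :
  mean (fun x => (\sum_(0 <= i < j) level_block l e i x) ^+ a * level_block l e j x ^+ b) =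
  mean (fun x => (\sum_(0 <= i < j) level_block l e i x) ^+ a) *
  mean (fun x => level_block l e j x ^+ b).
Proof.
apply: (@mean_independent _ _ _ _ res (fun k => k < (2 * j + e) * 2 ^ l)%N
  (fun k => (2 * j + e) * 2 ^ l <= k < (2 * j.+1 + e) * 2 ^ l)%N).
- by bdm_tac.
- by bdm_tac.
- apply/dependsX/depends_sum_nat => i ij.
  by apply: depends_sub (@depends_level_block _ _ _) => k; nia.
- exact/dependsX/depends_level_block.
- by move=> k; lia.
Qed.

Lemma mean_level l a : mean (level l a) = 0.
Proof.
by rewrite /level meanB// /local !mean_condE// mY subrr.
Qed.

Lemma mean_level_block l e b : mean (level_block l e b) = 0.
Proof. by rewrite mean_sum// big1// => i _; exact: mean_level. Qed.

Lemma sum_blocks (F : nat -> R) M N :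
  \sum_(0 <= a < N * (2 * M)) F a =
  \sum_(0 <= b < N) \sum_(0 <= i < M) F ((2 * b + 0) * M + i)%N +
  \sum_(0 <= b < N) \sum_(0 <= i < M) F ((2 * b + 1) * M + i)%N.
Proof.
elim: N => [|N IH]; first by rewrite mul0n !big_nil addr0.
rewrite !big_nat_recr//= addrACA -IH.
rewrite (@big_cat_nat _ _ _ (N * (2 * M)))//=; last by rewrite leq_mul2r leqnSn orbT.
congr (_ + _); rewrite (@big_cat_nat _ _ _ ((2 * N + 1) * M))//=; [|by nia..].
have -> : ((2 * N + 0) * M = N * (2 * M))%N by nia.
have sh (m p : nat) : (p = m + M)%N -> \sum_(m <= a < p) F a = \sum_(0 <= i < M) F (m + i)%N.
  move=> ->; rewrite -{1}(add0n m) big_addn addKn.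
  by apply: eq_bigr => k _; rewrite addnC.
by rewrite !sh//; nia.
Qed.

(** Rosenthal's inequality for the blocks of either parity; the factor 2 is the
    number of parities. *)
Lemma level_moment (beta L sigma : R) l N q r :
  0 <= beta -> 0 < L -> 0 <= sigma -> (0 < N)%N -> (0 < q)%N -> (0 < r)%N ->
  N%:R <= expR q%:R :> R ->
  Num.sqrt ((2 ^ l)%:R * (4 * 1)%:R) * \sum_((2 ^ l)./2 <= s < 2 ^ l) delta 1 s <= sigma ->
  (forall p, (0 < p)%N ->
    Num.sqrt ((2 ^ l)%:R * (4 * p)%:R) * \sum_((2 ^ l)./2 <= s < 2 ^ l) delta p s <=
    L * p%:R `^ beta) ->
  Lp_le mu (2 * r) (fun x => \sum_(0 <= a < N * 2 ^ l.+1) level l a x)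
    (2 * (expR 8 * (expR 1 * Num.sqrt (r%:R * N%:R) * sigma +
       4 * expR 1 ^+ 2 * 2 `^ beta * L * q%:R `^ beta * r%:R `^ Num.max beta 1))).
Proof.
move=> b0 L0 s0 N0 q0 r0 Nq hs hL.
have blk e b p (c : R) : (0 < p)%N ->
    Num.sqrt ((2 ^ l)%:R * (4 * p)%:R) * \sum_((2 ^ l)./2 <= s < 2 ^ l) delta p s <= c ->
    mean (fun x => level_block l e b x ^+ (2 * p)) <= c ^+ (2 * p).
  move=> p0 hc; apply: Lp_le_evenE; apply: Lp_le_trans hc _.
  by apply: block_moment => //; exact: half_expn2_le.
have half e : Lp_le mu (2 * r) (fun x => \sum_(0 <= b < N) level_block l e b x)
    (expR 8 * (expR 1 * Num.sqrt (r%:R * N%:R) * sigma +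
       4 * expR 1 ^+ 2 * 2 `^ beta * L * q%:R `^ beta * r%:R `^ Num.max beta 1)).
  apply: rosenthal_weibull => //.
  - exact: level_block_indep.
  - by move=> j; exact: mean_level_block.
  - by move=> j; exact: (blk e j 1%N).
  - by move=> j p p0; apply: blk => //; exact: hL.
rewrite mulr_natl mulr2n.
rewrite (_ : (fun x => _) = fun x => \sum_(0 <= b < N) level_block l 0 b x +
    \sum_(0 <= b < N) level_block l 1 b x); last first.
  by apply: funext => x; rewrite expnS sum_blocks.
by case: r r0 half => // r _ half; apply: Lp_leD => //; bdm_tac.
Qed.

End dyadic_levels.

(** * Geometric weights and the factor Omega *)

Section geometric_weights.
Context {R : realType}.
Implicit Types (nu x : R) (n l L : nat).

(** From [1 - 1/2 <= exp (- 1/2)]. *)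
Lemma ln2_ge_half : 2^-1 <= ln 2 :> R.
Proof.
rewrite -ler_expR lnK ?posrE//.
have h := expR_ge1Dx (- 2^-1 : R).
have e0 := expR_gt0 (2^-1 : R).
rewrite expRN in h.
have h2 := ler_wpM2r (ltW e0) h.
rewrite mulVf ?gt_eqF// in h2.
by lra.
Qed.

(** The bound (m + 1)^(- nu) at the smallest lag of level [l]. *)
Definition level_weight nu l : R := (((2 ^ l)./2).+1)%:R `^ (- nu).

Lemma powR_expn2 x l : ((2 ^ l)%:R : R) `^ x = (2 `^ x) ^+ l.
Proof. by rewrite natrX -powR_mulrn// powRAC powR_mulrn// powR_ge0. Qed.

Lemma level_weight0 nu : level_weight nu 0 = 1.
Proof. by rewrite /level_weight expn0 powR1. Qed.

Lemma level_weightS_le nu l : 0 <= nu -> level_weight nu l.+1 <= (2 `^ (- nu)) ^+ l.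
Proof.
move=> n0; rewrite /level_weight expnS mul2n doubleK -powR_expn2 !powRN.
rewrite lef_pV2 ?posrE ?powR_gt0 ?ltr0n ?expn_gt0//.
by apply: ge0_ler_powR; rewrite ?nnegrE// ler_nat.
Qed.

Lemma sqrt_level_weightS_le nu l : 0 <= nu ->
  Num.sqrt (2 ^ l.+1)%:R * level_weight nu l.+1 <= Num.sqrt 2 * (2 `^ (2^-1 - nu)) ^+ l.
Proof.
move=> n0; apply: (le_trans (ler_wpM2l _ (level_weightS_le l n0))); first by nonneg.
rewrite expnS natrM sqrtrM// -mulrA; apply: ler_wpM2l; first by nonneg.
rewrite -powR12_sqrt ?ler0n// powR_expn2 -exprMn -powRD//.
by rewrite pnatr_eq0 implybT.
Qed.

Lemma geometric_sum_le x L : 0 <= x -> x < 1 -> \sum_(0 <= l < L) x ^+ l <= (1 - x)^-1.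
Proof.
move=> x0 x1; have y0 : 0 < 1 - x by rewrite subr_gt0.
rewrite -[leRHS]mul1r ler_pdivlMr//.
suff -> : (\sum_(0 <= l < L) x ^+ l) * (1 - x) = 1 - x ^+ L by rewrite gerBl; nonneg.
elim: L => [|L IH]; first by rewrite big_nil mul0r expr0 subrr.
by rewrite big_nat_recr//= mulrDl IH exprS; ring.
Qed.

Lemma sum_level_weight_le nu L : 0 < nu ->
  \sum_(0 <= l < L.+1) level_weight nu l <= 1 + (1 - 2 `^ (- nu))^-1.
Proof.
move=> n0; rewrite big_nat_recl//= level_weight0 lerD2l.
apply: le_trans (geometric_sum_le L (_ : 0 <= 2 `^ (- nu)) _); last 2 first.
- by nonneg.
- rewrite powRN invf_lt1 ?powR_gt0//.
  by rewrite /powR pnatr_eq0 expR_gt1 mulr_gt0// ln_gt0// ltr1n.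
by apply: ler_sum => l _; apply: level_weightS_le; exact: ltW.
Qed.

Definition geometric_sum nu L : R := \sum_(0 <= l < L) (2 `^ (2^-1 - nu)) ^+ l.

Lemma geometric_sum_ge1 nu L : (0 < L)%N -> 1 <= geometric_sum nu L.
Proof.
case: L => // L _; rewrite /geometric_sum big_nat_recl//= expr0 lerDl.
by nonneg.
Qed.

Lemma sum_sqrt_level_weight_le nu L : 0 < nu -> (0 < L)%N ->
  \sum_(0 <= l < L.+1) Num.sqrt (2 ^ l)%:R * level_weight nu l <= 3 * geometric_sum nu L.
Proof.
move=> n0 L0; rewrite big_nat_recl//= level_weight0 expn0 sqrtr1 mulr1.
have g1 := geometric_sum_ge1 nu L0.
apply: (@le_trans _ _ (1 + 2 * geometric_sum nu L)); last by lra.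
rewrite lerD2l /geometric_sum mulr_sumr; apply: ler_sum => l _.
apply: le_trans (sqrt_level_weightS_le l (ltW n0)) _.
apply: ler_wpM2r; first by nonneg.
apply: (@le_trans _ _ (Num.sqrt (2 ^+ 2))); last by rewrite sqrtr_sqr ger0_norm.
by rewrite ler_wsqrtr//; lra.
Qed.

Lemma last_level_le nu L : 0 < nu -> (0 < L)%N ->
  Num.sqrt (2 ^ L)%:R * ((2 ^ L)%:R) `^ (- nu) <= 2 * geometric_sum nu L.
Proof.
move=> n0; case: L => // L _.
rewrite -powR12_sqrt ?ler0n// -powRD; last by rewrite pnatr_eq0 expn_eq0 implybT.
rewrite powR_expn2 exprS; apply: ler_pM; [by nonneg|by nonneg| |].
  rewrite -[leRHS]powRr1//; apply: ler_powR; first by rewrite ler1n.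
  by lra.
rewrite /geometric_sum big_nat_recr//= lerDr; nonneg.
Qed.

Lemma trunc_log_le_log2 n : (0 < n)%N -> (trunc_log 2 n)%:R <= log2 n%:R :> R.
Proof.
move=> n0; have l2 : 0 < ln 2 :> R by rewrite ln_gt0// ltr1n.
rewrite /log2 ler_pdivlMr// mulrC mulr_natr -lnXn// ler_ln ?posrE ?exprn_gt0 ?ltr0n//.
by rewrite -natrX ler_nat; exact: trunc_logP.
Qed.

Lemma trunc_logS_le_ln n : (2 <= n)%N -> (trunc_log 2 n).+1%:R <= 4 * ln n%:R :> R.
Proof.
move=> n2; have l2 := ln2_ge_half.
have L1 : (1 <= trunc_log 2 n)%N by exact: trunc_log_max.
have := trunc_log_le_log2 (ltnW n2).
rewrite /log2 ler_pdivlMr; last by lra.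
have L1' : 1 <= (trunc_log 2 n)%:R :> R by rewrite ler1n.
rewrite -natr1; nra.
Qed.

(** With [x] the ratio 2^(1/2 - nu), the sum is at most [1 / (1 - x)] for
    [nu > 1/2] and [x ^ L / (x - 1)] for [nu < 1/2]. The cubes in Omega are then
    much more than needed near [1/2]; for large [nu] the factor [2 ^ nu]
    compensates for them, by the cubic term of the exponential series. For
    [nu = 1/2] there is one unit term per level. *)
Lemma geometric_sum_Omega n nu : (2 <= n)%N -> 0 < nu ->
  geometric_sum nu (trunc_log 2 n) <= 10 * Omega n nu.
Proof.
move=> n2 nu0; set L := trunc_log 2 n.
have L1 : (1 <= L)%N by exact: trunc_log_max.
have l2 := ln2_ge_half.
have nu1 : 1 <= 2 `^ nu :> R.
  have h2 : 1 <= 2 :> R by rewrite ler1n.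
  by have := ler_powR h2 (ltW nu0); rewrite powRr0.
have n0 : 0 < n%:R :> R by rewrite ltr0n; lia.
rewrite /Omega; case: ltgtP => [h|h|h].
- pose x := nu - 2^-1; have x0 : 0 < x by rewrite subr_gt0.
  have e : 2^-1 - nu = - x by rewrite opprB.
  pose z : R := 2 `^ x.
  have zE : z = expR (x * ln 2) by rewrite /z /powR pnatr_eq0.
  have z1 : x ^+ 3 / 48 <= z - 1.
    have y0 : 0 <= x * ln 2 by apply: mulr_ge0; lra.
    have := expR_ge1Dxn 2 y0; rewrite -zE (_ : 3`! = 6)%N//.
    have : (x / 2) ^+ 3 <= (x * ln 2) ^+ 3.
      apply: lerXn2r; rewrite ?nnegrE//; first by lra.
      by apply: ler_wpM2l; lra.
    rewrite expr_div_n (_ : (2 : R) ^+ 3 = 8); last by ring.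
    by lra.
  have x3 : 0 < x ^+ 3 by rewrite exprn_gt0.
  have z1' : 0 < z - 1 by apply: lt_le_trans z1; rewrite divr_gt0.
  have z0 : 0 < z by lra.
  apply: (@le_trans _ _ (z / (z - 1))).
    rewrite /geometric_sum e powRN -/z.
    have -> : z / (z - 1) = (1 - z^-1)^-1 by field; rewrite !gt_eqF.
    by apply: geometric_sum_le; [rewrite invr_ge0 ltW|rewrite invf_lt1//; lra].
  rewrite ler_pdivrMr//.
  have zn : z <= 2 `^ nu by apply: ler_powR; [rewrite ler1n|rewrite /x; lra].
  have -> : 10 * (2 `^ nu * (5 / (nu - 2^-1) ^+ 3)) * (z - 1) =
      2 `^ nu * (50 * (z - 1) / x ^+ 3) by rewrite /x; ring.
  rewrite -[leLHS]mulr1; apply: ler_pM => //; first by exact: ltW.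
  by rewrite ler_pdivlMr// mul1r; lra.
- pose y := 2^-1 - nu; have y0 : 0 < y by rewrite subr_gt0.
  rewrite -/y.
  pose z : R := 2 `^ y.
  have zE : z = expR (y * ln 2) by rewrite /z /powR pnatr_eq0.
  have z1 : y / 2 <= z - 1.
    have := expR_ge1Dx (y * ln 2); rewrite -zE.
    have : y * 2^-1 <= y * ln 2 by apply: ler_wpM2l; lra.
    by lra.
  have y2 : 0 < y / 2 by lra.
  have zL : z ^+ L <= (2 * n%:R) `^ y.
    rewrite /z -powR_expn2; apply: ge0_ler_powR; rewrite ?nnegrE//; first exact: ltW.
    apply: (@le_trans _ _ n%:R); last by lra.
    by rewrite ler_nat; apply: trunc_logP => //; lia.
  have gE : geometric_sum nu L * (z - 1) = z ^+ L - 1.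
    rewrite /geometric_sum -/y -/z; elim: (L) => [|l IH].
      by rewrite big_nil mul0r expr0 subrr.
    by rewrite big_nat_recr//= mulrDl IH exprS; ring.
  have g0 : 0 <= geometric_sum nu L by rewrite /geometric_sum; nonneg.
  have P0 : 0 <= (2 * n%:R) `^ y by nonneg.
  have h1 : geometric_sum nu L * (y / 2) <= (2 * n%:R) `^ y.
    apply: (@le_trans _ _ (geometric_sum nu L * (z - 1))); first exact: ler_wpM2l.
    by rewrite gE; lra.
  have y3 : 0 < y ^+ 3 by rewrite exprn_gt0.
  have h2 : geometric_sum nu L <= 50 * (2 * n%:R) `^ y / y ^+ 3.
    rewrite ler_pdivlMr// exprS exprS expr1.
    have : y * y * (geometric_sum nu L * (y / 2)) <= 2^-1 * 2^-1 * (2 * n%:R) `^ y.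
      have yh : y <= 2^-1 by rewrite /y; lra.
      apply: ler_pM => //; [by nonneg|by nonneg|].
      by apply: ler_pM => //; exact: ltW.
    by lra.
  apply: le_trans h2 _.
  have -> : 10 * (2 `^ nu * (5 * (2 * n%:R) `^ y / y ^+ 3)) =
    2 `^ nu * (50 * (2 * n%:R) `^ y / y ^+ 3) by ring.
  by rewrite ler_peMl//; nonneg; exact: ltW.
- rewrite -h.
  have -> : geometric_sum (2^-1) L = L%:R.
    rewrite /geometric_sum subrr powRr0; under eq_bigr do rewrite expr1n.
    by rewrite sumr_const_nat subn0.
  have LL : L%:R <= log2 n%:R :> R by apply: trunc_log_le_log2; lia.
  have l1 : 1 <= log2 n%:R :> R by apply: le_trans LL; rewrite ler1n.
  have : log2 n%:R `^ 1 <= log2 n%:R `^ (5 / 2) :> R by apply: ler_powR => //; lra.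
  rewrite powRr1; last by lra.
  rewrite -h in nu1; nra.
Qed.

End geometric_weights.

(** * Moments of sums of functions of finitely many coordinates *)

Section local_sum.
Context {R : realType} d (S : measurableType d) (mu : probability (pasts S) R).
Hypothesis res : resamplable mu.
Variable Y : nat -> pasts S -> R.
Hypothesis bY : forall a, bdm (Y a).
Hypothesis mY : forall a, mean mu (Y a) = 0.
Variable delta : nat -> nat -> R.
Hypothesis delta0 : forall k s, 0 <= delta k s.
Hypothesis Ydelta : forall k a s, (0 < k)%N ->
  mean mu (fun x => (Y a x - condE mu (predC1 (a + s)%N) (Y a) x) ^+ (2 * k)) <=
    delta k s ^+ (2 * k).
Variables (n : nat) (nu alpha K D : R).
Hypotheses (n2 : (2 <= n)%N) (nu0 : 0 < nu) (alpha0 : 0 < alpha).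
Hypotheses (K0 : 0 < K) (D0 : 0 <= D).
Hypothesis Y0 : forall a, (n <= a)%N -> Y a = (fun=> 0).
Hypothesis deltaK : forall k m M, (0 < k)%N ->
  \sum_(m <= s < M) delta k s <= K * (2 * k%:R) `^ alpha^-1 * m.+1%:R `^ (- nu).
Hypothesis deltaD : forall m M, \sum_(m <= s < M) delta 1 s <= D * m.+1%:R `^ (- nu).

Let beta := 2^-1 + alpha^-1.
Let beta0 : 0 <= beta.
Proof. by rewrite /beta addr_ge0// invr_ge0 ltW. Qed.

Let kappa : R := 2 `^ alpha^-1.
Let kappa0 : 0 < kappa. Proof. by rewrite powR_gt0. Qed.

Let root_split (x : R) p : 0 <= x -> (0 < p)%N ->
  Num.sqrt (x * (4 * p)%:R) * (2 * p%:R) `^ alpha^-1 = 2 * kappa * Num.sqrt x * p%:R `^ beta.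
Proof.
move=> x0 p0; have p0' : 0 < p%:R :> R by rewrite ltr0n.
rewrite natrM sqrtrM// sqrtrM ?ler0n// powRM//.
rewrite (_ : (4%:R : R) = 2 ^+ 2); last by rewrite -natrX.
rewrite sqrtr_sqr ger0_norm// /beta powRD; last by rewrite (gt_eqF p0') implybT.
by rewrite powR12_sqrt ?ltW// /kappa; ring.
Qed.

Let reassoc (u v x y : R) : u * (v * x * y) = u * x * (v * y).
Proof. by ring. Qed.

Let local_zero a m : (n <= a)%N -> local mu Y a m = (fun=> 0).
Proof.
by move=> na; apply: funext => x; rewrite /local /condE Y0//; exact: mean_cst.
Qed.

Let q := (trunc_log 2 n).+1.
Let cB : R := 16 * expR 8 * expR 1.
Let cC : R := 16 * expR 8 * expR 1 ^+ 2 * 2 `^ beta * kappa.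

Let one_level l r : (0 < r)%N -> (l <= trunc_log 2 n)%N ->
  Lp_le mu (2 * r) (fun x => \sum_(0 <= a < n) level mu Y l a x)
   (cB * Num.sqrt r%:R * Num.sqrt n%:R * D * level_weight nu l +
    cC * K * q%:R `^ beta * r%:R `^ Num.max beta 1 *
      (Num.sqrt (2 ^ l)%:R * level_weight nu l)).
Proof.
move=> r0 lL.
have n0 : (0 < n)%N by lia.
have ln : (2 ^ l <= n)%N.
  apply: (@leq_trans (2 ^ trunc_log 2 n)); first by rewrite leq_exp2l.
  exact: trunc_logP.
(* The number of blocks of each parity; the last ones may reach beyond [n],
   where [Y] vanishes. *)
pose N := (n %/ 2 ^ l.+1).+1.
have p2 : (0 < 2 ^ l.+1)%N by rewrite expn_gt0.
have nN : (n <= N * 2 ^ l.+1)%N by apply: ltnW; exact: ltn_ceil.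
have N2 : (N * 2 ^ l <= 2 * n)%N.
  have := leq_trunc_div n (2 ^ l.+1); rewrite /N mulSn expnS; nia.
have Nn : (N <= n)%N.
  rewrite /N; apply: (@leq_trans (n %/ 2).+1); last by lia.
  by rewrite ltnS leq_div2l// expnS leq_pmulr// expn_gt0.
have Nq : N%:R <= expR q%:R :> R.
  apply: (@le_trans _ _ (2 ^ q)%:R).
    by rewrite ler_nat (leq_trans Nn)// ltnW// trunc_log_ltn.
  rewrite natrX -[q%:R]mulr1 expRM_natl; apply: lerXn2r; rewrite ?nnegrE//.
  by have := expR_ge1Dx (1 : R); lra.
set w := level_weight nu l.
have w0 : 0 < w by rewrite powR_gt0.
have w0' := ltW w0.
have s2 : 0 < Num.sqrt (2 ^ l)%:R :> R by rewrite sqrtr_gt0 ltr0n expn_gt0.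
have s2' := ltW s2.
have k0' := ltW kappa0. have K0' := ltW K0.
pose L : R := 2 * kappa * Num.sqrt (2 ^ l)%:R * (K * w).
pose sigma : R := 2 * Num.sqrt (2 ^ l)%:R * (D * w).
have L0 : 0 < L by rewrite /L !mulr_gt0.
have s0 : 0 <= sigma by rewrite /sigma; nonneg.
have h := @level_moment _ _ _ mu res Y bY mY delta delta0 Ydelta beta L sigma l N q r
  beta0 L0 s0 isT isT r0 Nq.
have {h} := h _ _.
rewrite (_ : (fun x => _) = (fun x => \sum_(0 <= a < n) level mu Y l a x)); last first.
  apply: funext => x; rewrite (@big_cat_nat _ _ _ n)//= -[RHS]addr0; congr (_ + _).
  rewrite big_nat_cond big1// => a /andP[/andP[na _] _].
  by rewrite /level !local_zero// subrr.
move=> h; apply: Lp_le_trans (h _ _) => {h}.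
- rewrite mulrA mulrDr; apply: lerD; last first.
    apply: eq_leW; rewrite /cC /L; ring.
  have -> : sigma = 2 * Num.sqrt (2 ^ l)%:R * (D * w) by [].
  have h1 : Num.sqrt (r%:R * N%:R) * Num.sqrt (2 ^ l)%:R <=
      2 * (Num.sqrt r%:R * Num.sqrt n%:R) :> R.
    have -> : 2 = Num.sqrt (4%:R) :> R.
      by rewrite (_ : (4%:R : R) = 2 ^+ 2) ?sqrtr_sqr ?ger0_norm// -natrX.
    rewrite -!sqrtrM//.
    apply: ler_wsqrtr; rewrite -!natrM ler_nat.
    apply: (@leq_trans (r * (2 * n))); first by rewrite -mulnA; apply: leq_mul.
    by rewrite mulnCA; apply: leq_mul.
  have h2 : 0 <= 4 * expR 8 * expR 1 * (D * w) :> R by nonneg.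
  have := ler_wpM2l h2 h1.
  have h3 : 0 <= expR 8 * expR 1 * (D * w) * (Num.sqrt r%:R * Num.sqrt n%:R) :> R by nonneg.
  rewrite /cB; lra.
- rewrite /sigma -[leRHS]mulrA; rewrite natrM mulr1 sqrtrM//.
  rewrite (_ : Num.sqrt (4%:R : R) = 2); last first.
    by rewrite (_ : (4%:R : R) = 2 ^+ 2) ?sqrtr_sqr ?ger0_norm// -natrX.
  rewrite -mulrA mulrCA; apply: ler_wpM2l => //; apply: ler_wpM2l => //.
- move=> p p0; apply: (le_trans (ler_wpM2l _ (deltaK _ _ p0))); first by nonneg.
  rewrite -/(level_weight nu l) -/w reassoc root_split//.
  by apply: eq_leW; rewrite /L; ring.
Qed.

Let tail_part r M : (0 < r)%N -> (2 ^ trunc_log 2 n <= M)%N ->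
  Lp_le mu (2 * r)
   (fun x => \sum_(0 <= a < n) (local mu Y a M x - local mu Y a (2 ^ trunc_log 2 n) x))
   (8 * kappa * K * r%:R `^ beta * geometric_sum nu (trunc_log 2 n)).
Proof.
move=> r0 LM; set L := trunc_log 2 n.
have L1 : (0 < L)%N by exact: trunc_log_max.
have k0' := ltW kappa0. have K0' := ltW K0.
apply: Lp_le_trans (@block_moment _ _ _ mu res Y bY delta delta0 Ydelta r 0%N n _ _ r0 LM).
apply: (le_trans (ler_wpM2l _ (deltaK _ _ r0))); first by nonneg.
rewrite reassoc root_split//.
have h := last_level_le nu0 L1.
have h1 : (2 ^ L).+1%:R `^ (- nu) <= (2 ^ L)%:R `^ (- nu) :> R.
  rewrite !powRN lef_pV2 ?posrE ?powR_gt0 ?ltr0n ?expn_gt0//.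
  by apply: ge0_ler_powR; rewrite ?nnegrE ?ler_nat//; exact: ltW.
have h2 : Num.sqrt n%:R <= 2 * Num.sqrt (2 ^ L)%:R :> R.
  have -> : 2 = Num.sqrt (4%:R) :> R.
    by rewrite (_ : (4%:R : R) = 2 ^+ 2) ?sqrtr_sqr ?ger0_norm// -natrX.
  rewrite -sqrtrM//; apply: ler_wsqrtr; rewrite -natrM ler_nat.
  have : (n < 2 ^ L.+1)%N by exact: trunc_log_ltn.
  by rewrite expnS; lia.
have h3 : Num.sqrt n%:R * (2 ^ L).+1%:R `^ (- nu) <=
    2 * Num.sqrt (2 ^ L)%:R * (2 ^ L)%:R `^ (- nu) :> R.
  by apply: ler_pM => //; nonneg.
have h4 : 0 <= 2 * kappa * r%:R `^ beta * K by nonneg.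
have := ler_wpM2l h4 h3.
have := ler_wpM2l h4 h; lra.
Qed.

(** All levels up to the one whose blocks have length about [n], and the rest of
    the lags treated as one block. *)
Lemma local_sum_moment r M : (0 < r)%N -> (2 ^ trunc_log 2 n <= M)%N ->
  Lp_le mu (2 * r) (fun x => \sum_(0 <= a < n) local mu Y a M x)
   (cB * (1 + (1 - 2 `^ (- nu))^-1) * (Num.sqrt r%:R * Num.sqrt n%:R * D) +
    (3 * cC + 8 * kappa) * K * q%:R `^ beta * r%:R `^ Num.max beta 1 *
      geometric_sum nu (trunc_log 2 n)).
Proof.
move=> r0 LM; set L := trunc_log 2 n.
have L1 : (0 < L)%N by exact: trunc_log_max.
have k0' := ltW kappa0. have K0' := ltW K0.
pose u l := cB * Num.sqrt r%:R * Num.sqrt n%:R * D * level_weight nu l +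
    cC * K * q%:R `^ beta * r%:R `^ Num.max beta 1 *
      (Num.sqrt (2 ^ l)%:R * level_weight nu l).
have sum_part : Lp_le mu (2 * r)
    (fun x => \sum_(0 <= l < L.+1) \sum_(0 <= a < n) level mu Y l a x)
    (\sum_(0 <= l < L.+1) u l).
  have := leqnn L; elim: {1 3 4}L => [|l IH] lL.
    rewrite big_nat1; under [X in Lp_le _ _ X]eq_fun do rewrite big_nat1.
    exact: one_level.
  rewrite big_nat_recr//=; under [X in Lp_le _ _ X]eq_fun do rewrite big_nat_recr//=.
  have h1 := IH (ltnW lL); have h2 := one_level r0 lL.
  apply: Lp_leD_gt0 => //; first by rewrite muln_gt0.
    by apply: bdm_sum => i _; apply: bdm_sum => j _; exact: bdm_level.
  by apply: bdm_sum => j _; exact: bdm_level.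
have := tail_part r0 LM; rewrite -/L => tail.
have bl : bdm (fun x => \sum_(0 <= l < L.+1) \sum_(0 <= a < n) level mu Y l a x).
  by apply: bdm_sum => i _; apply: bdm_sum => j _; exact: bdm_level.
have bt : bdm (fun x => \sum_(0 <= a < n) (local mu Y a M x - local mu Y a (2 ^ L) x)).
  by apply: bdm_sum => j _; apply: bdmB; exact: bdm_local.
have -> : (fun x => \sum_(0 <= a < n) local mu Y a M x) =
    (fun x => \sum_(0 <= l < L.+1) \sum_(0 <= a < n) level mu Y l a x +
      \sum_(0 <= a < n) (local mu Y a M x - local mu Y a (2 ^ L) x)).
  apply: funext => x; rewrite exchange_big/= -big_split/=; apply: eq_bigr => a _.
  by rewrite sum_levels// addrC subrK.
suff : Lp_le mu (2 * r) (fun x => \sum_(0 <= l < L.+1) \sum_(0 <= a < n) level mu Y l a x +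
      \sum_(0 <= a < n) (local mu Y a M x - local mu Y a (2 ^ L) x))
    (\sum_(0 <= l < L.+1) u l + 8 * kappa * K * r%:R `^ beta * geometric_sum nu L).
  apply: Lp_le_trans.
  rewrite /u big_split/= -!mulr_sumr -addrA; apply: lerD.
    rewrite [leRHS](_ : _ = cB * Num.sqrt r%:R * Num.sqrt n%:R * D *
      (1 + (1 - 2 `^ (- nu))^-1)); last by ring.
    apply: ler_wpM2l; first by rewrite /cB; nonneg.
    exact: sum_level_weight_le.
  have g1 := geometric_sum_ge1 nu L1.
  have g0 : 0 <= geometric_sum nu L by lra.
  have q1 : 1 <= q%:R `^ beta by exact: powR_nat_ge1.
  have r1 : r%:R `^ beta <= r%:R `^ Num.max beta 1.
    by apply: ler_powR; rewrite ?ler1n// le_max lexx.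
  have h0 : 0 <= cC * K * q%:R `^ beta * r%:R `^ Num.max beta 1 by rewrite /cC; nonneg.
  have h1 := ler_wpM2l h0 (sum_sqrt_level_weight_le nu0 L1).
  have h2 : r%:R `^ beta <= q%:R `^ beta * r%:R `^ Num.max beta 1.
    by rewrite -[leLHS]mul1r; apply: ler_pM => //; nonneg.
  have h3 : 0 <= 8 * kappa * K * geometric_sum nu L by nonneg.
  have h4 := ler_wpM2l h3 h2.
  lra.
by apply: Lp_leD_gt0 => //; rewrite muln_gt0.
Qed.

End local_sum.

(** * Levy's upward theorem *)

Import HBSimple.

Section levy.
Context {R : realType} d (S : measurableType d) (mu : probability (pasts S) R).
Notation mean := (mean mu).
Implicit Types (f g h : pasts S -> R) (A B : set (pasts S)).

Definition below m : pred nat := fun k => (k < m)%N.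

Definition approximable f := forall e, 0 < e ->
  exists m h, [/\ bdm h, depends (below m) h & mean (fun x => `|f x - h x|) <= e].

Lemma approximable_le f (F : R -> pasts S -> R) : bdm f ->
  (forall e, 0 < e -> bdm (F e) /\ mean (fun x => `|f x - F e x|) <= e) ->
  (forall e, 0 < e -> approximable (F e)) -> approximable f.
Proof.
move=> bf fF aF e e0.
have e20 : 0 < e / 2 by rewrite divr_gt0.
have [bF Fe] := fF _ e20.
have [m [h [bh dh Fh]]] := aF _ e20 _ e20; exists m, h; split => //.
apply: (@le_trans _ _ (mean (fun x => `|f x - F (e / 2) x| + `|F (e / 2) x - h x|))).
  apply: mean_le => [||x]; [by bdm_tac..|].
  by rewrite -[f x - h x](subrKA (F (e / 2) x)) ler_normD.
rewrite meanD; [|by bdm_tac..].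
by rewrite [leRHS]splitr lerD.
Qed.

Lemma approximable_lip2 (phi : R -> R -> R) f g :
  (forall f g, bdm f -> bdm g -> bdm (fun x => phi (f x) (g x))) ->
  (forall a b c d, `|phi a b - phi c d| <= `|a - c| + `|b - d|) ->
  bdm f -> bdm g -> approximable f -> approximable g ->
  approximable (fun x => phi (f x) (g x)).
Proof.
move=> bphi lphi bf bg af ag e e0.
have e20 : 0 < e / 2 by rewrite divr_gt0.
have [m [h [bh dh fh]]] := af _ e20; have [m' [h' [bh' dh' gh]]] := ag _ e20.
exists (maxn m m'), (fun x => phi (h x) (h' x)); split.
- exact: bphi.
- have d1 : depends (below (maxn m m')) h.
    by apply: depends_sub dh => k; rewrite /below; lia.
  have d2 : depends (below (maxn m m')) h'.
    by apply: depends_sub dh' => k; rewrite /below; lia.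
  by move=> x y; rewrite d1 d2.
apply: (@le_trans _ _ (mean (fun x => `|f x - h x| + `|g x - h' x|))).
  apply: mean_le => [||x]; [|by bdm_tac|exact: lphi].
  by apply/bdm_norm/bdmB; exact: bphi.
rewrite meanD; [|by bdm_tac..].
by rewrite [leRHS]splitr lerD.
Qed.

Lemma approximableD f g : bdm f -> bdm g -> approximable f -> approximable g ->
  approximable (fun x => f x + g x).
Proof.
apply: (@approximable_lip2 +%R) => [? ? ? ?|a b c d0]; first by bdm_tac.
by rewrite opprD addrACA ler_normD.
Qed.

Lemma approximableZ c f : bdm f -> approximable f -> approximable (fun x => c * f x).
Proof.
move=> bf af e e0.
have c0 : 0 < `|c| + 1 by rewrite ltr_wpDl.
have [m [h [bh dh fh]]] := af _ (divr_gt0 e0 c0); exists m, (fun x => c * h x).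
split; [by bdm_tac|by move=> x y; rewrite dh|].
apply: (@le_trans _ _ (`|c| * mean (fun x => `|f x - h x|))).
  rewrite -meanZ; last by bdm_tac.
  by apply: mean_le => [||x]; [by bdm_tac..|rewrite -mulrBr normrM].
apply: (@le_trans _ _ (`|c| * (e / (`|c| + 1)))); first exact: ler_wpM2l.
rewrite mulrA ler_pdivrMr// mulrC; apply: ler_wpM2l; first exact: ltW.
by rewrite lerDl.
Qed.

Lemma approximable_cst (c : R) : approximable (fun=> c).
Proof.
move=> e e0; exists 0%N, (fun=> c); split => //.
by under [X in mean X]eq_fun do rewrite subrr normr0; rewrite mean_cst ltW.
Qed.

Lemma bdm_indic A : measurable A -> bdm (\1_A : pasts S -> R).
Proof.
move=> mA; split; first exact: measurable_indic.
by exists 1 => x; rewrite indicE; case: (_ \in _); rewrite ?normr1// normr0.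
Qed.

Lemma mean_indic A : measurable A -> (mean \1_A)%:E = mu A.
Proof.
by move=> mA; rewrite -mean_EFin ?integral_indic ?setIT//; exact: bdm_indic.
Qed.

(** The sets whose indicators are approximable form a sigma-algebra that
    contains the cylinders. *)
Lemma approximable_indic A : measurable A -> approximable (\1_A).
Proof.
move=> mA; suff : [set A | measurable A /\ approximable (\1_A)] A by case.
apply: (@smallest_sub _ _ (@cylinders d S)) mA.
  split => /=.
  - split => //; rewrite (_ : \1_set0 = fun=> 0); first exact: approximable_cst.
    by apply: funext => x; rewrite indic0.
  - move=> B [mB aB]; split; first exact: measurableD.
    rewrite (_ : \1__ = fun x => 1 + -1 * \1_B x); last first.
      apply: funext => x; rewrite !indicE in_setD in_setT andTb.
      by case: (_ \in _) => /=; lra.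
    apply: approximableD; [by []|by apply: bdmZ; exact: bdm_indic|exact: approximable_cst|].
    by apply: approximableZ => //; exact: bdm_indic.
  - move=> F hF; have mF k : @measurable _ (pasts S) (F k) by have [] := hF k.
    have mU : @measurable _ (pasts S) (\bigcup_k F k) by exact: bigcupT_measurable.
    split => //; pose U N : set (pasts S) := \big[setU/set0]_(i < N) F i.
    have mUN N : measurable (U N) by apply: bigsetU_measurable.
    have aU N : approximable (\1_(U N)).
      elim: N => [|N IH].
        rewrite /U big_ord0 (_ : \1_set0 = fun=> 0); first exact: approximable_cst.
        by apply: funext => x; rewrite indic0.
      rewrite (_ : \1_(U N.+1) = fun x => Num.max (\1_(U N) x) (\1_(F N) x)); last first.
        apply: funext => x; rewrite /U big_ord_recr/= !indicE in_setU.
        by case: (_ \in _); case: (_ \in _) => /=; case: leP => //=; lra.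
      apply: (@approximable_lip2 Num.max); [| |exact: bdm_indic|exact: bdm_indic|by []|by have [] := hF N].
        move=> f g [mf [a fa]] [mg [b gb]]; split; first exact: measurable_maxr.
        exists (Num.max a b) => x; rewrite /Num.max; case: ifP => _.
          by rewrite le_max gb orbT.
        by rewrite le_max fa.
      move=> a b c d0; have h1 := ler_norm (a - c); have h2 := ler_norm (b - d0).
      have h3 := ler_norm (c - a); have h4 := ler_norm (d0 - b).
      rewrite distrC in h3; rewrite distrC in h4.
      rewrite ler_norml; apply/andP.
      by split; case: (leP a b) => ab; case: (leP c d0) => cd; lra.
    have cvgU : fine (mu (U N)) @[N --> \oo] --> fine (mu (\bigcup_k F k)).
      have UE : \bigcup_k F k = \bigcup_N U N.
        apply/seteqP; split => x [k _ Fx].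
          by exists k.+1 => //; rewrite /U -bigcup_mkord; exists k => /=.
        by move: Fx; rewrite /U -bigcup_mkord => -[i _ Fi]; exists i.
      have mUU : measurable (\bigcup_N U N) by rewrite -UE.
      have ndU : nondecreasing_seq U by move=> i j ij; apply/subsetPset; exact: subset_bigsetU.
      have h := nondecreasing_cvg_mu (mu := mu) mUN mUU ndU.
      apply: fine_cvg; rewrite fineK; last exact: fin_num_measure.
      by rewrite UE; exact: h.
    have /choice[N HN] : forall e : R, exists N, 0 < e ->
        mean (fun x => `|\1_(\bigcup_k F k) x - \1_(U N) x|) <= e.
      move=> e; have [e0|e0] := ltP 0 e; last by exists 0%N.
      have /cvgrPdist_le/(_ e e0)[N _ /(_ N (leqnn N))] := cvgU.
      move=> h; exists N => _.
      have UN : U N `<=` \bigcup_k F k by apply: bigsetU_bigcup.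
      rewrite (_ : (fun x => _) = fun x => \1_(\bigcup_k F k) x - \1_(U N) x); last first.
        apply: funext => x; rewrite ger0_norm// !indicE.
        have [xU|] := boolP (x \in U N); last by case: (_ \in _) => _ /=; lra.
        by rewrite (mem_set (UN _ (set_mem xU))) subrr.
      rewrite meanB ?bdm_indic//; try exact: bdm_indic.
      apply: le_trans (ler_norm _) _; move: h.
      by rewrite -!mean_indic.
    apply: (@approximable_le _ (fun e => \1_(U (N e)))) => [|e e0|e e0].
    + exact: bdm_indic.
    + by split; [exact: bdm_indic|exact: HN].
    + exact: aU.
move=> B [k _ [C mC <-]]; rewrite setTI /=.
have mB : measurable ((fun x : pasts S => x k) @^-1` C).
  by rewrite -[X in measurable X]setTI; exact: measurable_coord.
split => // e e0; exists k.+1, (\1_((fun x : pasts S => x k) @^-1` C)); split.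
- exact: bdm_indic.
- move=> x y; rewrite !indicE; congr ((nat_of_bool _)%:R).
  by apply/idP/idP; rewrite !inE /= /mix /below ltnSn.
- by under [X in mean X]eq_fun do rewrite subrr normr0; rewrite mean_cst ltW.
Qed.

Lemma approximable_bdm f : bdm f -> approximable f.
Proof.
move=> bf; have [g [ig _ gf]] := approximation_sfun_integrable measurableT (bdm_integrable mu bf).
have bg n : bdm (g n : pasts S -> R).
  split => //; have [M [_ hM]] := simple_bounded (g n).
  by exists (M + 1) => x; apply: hM => //; rewrite ltrDl.
have /choice[N HN] : forall e : R, exists N, 0 < e ->
    mean (fun x => `|f x - g N x|) <= e.
  move=> e; have [e0|e0] := ltP 0 e; last by exists 0%N.
  have /fine_fcvg/cvgrPdist_le/(_ e e0)[N _ /(_ N (leqnn N))] := gf.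
  move=> h; exists N => _; move: h; rewrite /= sub0r normrN.
  exact/le_trans/ler_norm.
apply: (@approximable_le _ (fun e => g (N e))) => // [e e0|e e0].
  by split => //; exact: HN.
rewrite (_ : (g (N e) : _ -> _) = fun x =>
  \sum_(y <- fset_set (range (g (N e)))) y * \1_(g (N e) @^-1` [set y]) x); last first.
  by apply: funext => x; rewrite fimfunE fsbig_finite.
elim: (finmap.enum_fset _) => [|y r IH].
  by under [X in approximable X]eq_fun do rewrite big_nil; exact: approximable_cst.
under [X in approximable X]eq_fun do rewrite big_cons.
have by_ z : bdm (fun x => z * \1_(g (N e) @^-1` [set z]) x).
  by apply: bdmZ; exact: bdm_indic.
apply: approximableD; [exact: by_|by apply: bdm_sum => ? _; exact: by_| |exact: IH].
by apply: approximableZ; [exact: bdm_indic|exact: approximable_indic].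
Qed.

Hypothesis res : resamplable mu.

(** Levy's upward theorem: a function of finitely many coordinates close to [f]
    is eventually fixed by the conditioning, which does not increase distances
    in L^1. *)
Lemma condE_below_cvg f e : bdm f -> 0 < e ->
  exists m0, forall m, (m0 <= m)%N -> mean (fun x => `|f x - condE mu (below m) f x|) <= e.
Proof.
move=> bf e0; have e20 : 0 < e / 2 by rewrite divr_gt0.
have [m0 [h [bh dh fh]]] := approximable_bdm bf e20; exists m0 => m m0m.
have dm : depends (below m) h.
  by apply: depends_sub dh => k; rewrite /below; lia.
have bc := bdm_condE mu (below m) bf.
have bfh : bdm (fun x => `|f x - h x|) by bdm_tac.
have bc' := bdm_condE mu (below m) bfh.
apply: (@le_trans _ _ (mean (fun x =>
  `|f x - h x| + condE mu (below m) (fun x => `|f x - h x|) x))).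
  apply: mean_le => [||x]; [by bdm_tac..|].
  rewrite -[f x - _](subrKA (h x)); apply: le_trans (ler_normD _ _) _; rewrite lerD2l.
  have -> : h x - condE mu (below m) f x =
      - mean (fun y => f (mix (below m) x y) - h (mix (below m) x y)).
    rewrite meanB; [|exact: bdm_mixr..].
    by rewrite opprB -/(condE mu (below m) h x) (condE_id mu dm).
  rewrite normrN; apply: mean_norm; apply: bdmB; exact: bdm_mixr.
rewrite meanD// mean_condE// [leRHS]splitr; exact: lerD.
Qed.

End levy.

(** * Moments of sums of bounded functions of the past *)

Section constants_of_the_bound.
Context {R : realType}.
Implicit Types (nu alpha : R).

Definition gaussian_const nu : R :=
  16 * expR 8 * expR 1 * (1 + (1 - 2 `^ (- nu))^-1).

Definition weibull_const alpha : R :=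
  (3 * (16 * expR 8 * expR 1 ^+ 2 * 2 `^ (2^-1 + alpha^-1) * 2 `^ alpha^-1) +
   8 * 2 `^ alpha^-1) * 4 `^ (2^-1 + alpha^-1) * 10.

Lemma gaussian_const_ge0 nu : 0 < nu -> 0 <= gaussian_const nu.
Proof.
move=> nu0; rewrite /gaussian_const.
have h : 2 `^ (- nu) < 1 :> R.
  rewrite powRN invf_lt1 ?powR_gt0//.
  by rewrite /powR pnatr_eq0 expR_gt1 mulr_gt0// ln_gt0// ltr1n.
have h' : 0 <= 1 - 2 `^ (- nu) :> R by rewrite subr_ge0 ltW.
by nonneg.
Qed.

Lemma weibull_const_ge0 alpha : 0 <= weibull_const alpha.
Proof. by rewrite /weibull_const; nonneg. Qed.

Definition moment_bound (n r : nat) nu alpha (K D : R) : R :=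
  gaussian_const nu * (Num.sqrt r%:R * Num.sqrt n%:R * D) +
  weibull_const alpha * K * ln n%:R `^ (2^-1 + alpha^-1) * Omega n nu *
    r%:R `^ Num.max (2^-1 + alpha^-1) 1.

Lemma Omega_ge0 n nu : 0 <= Omega n nu.
Proof.
rewrite /Omega; case: ltgtP => h; last by nonneg.
- have h1 : 0 <= nu - 2^-1 by rewrite subr_ge0 ltW.
  by nonneg.
- have h1 : 0 <= 2^-1 - nu by rewrite subr_ge0 ltW.
  by nonneg.
Qed.

Lemma moment_bound_ge0 n r nu alpha K D : 0 < nu -> 0 <= K -> 0 <= D ->
  0 <= moment_bound n r nu alpha K D.
Proof.
move=> nu0 K0 D0; have := gaussian_const_ge0 nu0.
have := weibull_const_ge0 alpha; have := Omega_ge0 n nu.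
by rewrite /moment_bound => h1 h2 h3; nonneg.
Qed.

End constants_of_the_bound.

Section bounded_sum.
Context {R : realType} d (S : measurableType d) (mu : probability (pasts S) R).
Hypothesis res : resamplable mu.
Variable Y : nat -> pasts S -> R.
Hypothesis bY : forall a, bdm (Y a).
Hypothesis mY : forall a, mean mu (Y a) = 0.
Hypothesis dY : forall a, depends (fun k => a <= k)%N (Y a).
Variable delta : nat -> nat -> R.
Hypothesis delta0 : forall k s, 0 <= delta k s.
Hypothesis Ydelta : forall k a s, (0 < k)%N ->
  mean mu (fun x => (Y a x - condE mu (predC1 (a + s)%N) (Y a) x) ^+ (2 * k)) <=
    delta k s ^+ (2 * k).
Variables (n : nat) (nu alpha D : R).
Hypotheses (n2 : (2 <= n)%N) (nu0 : 0 < nu) (alpha0 : 0 < alpha) (D0 : 0 <= D).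
Hypothesis Y0 : forall a, (n <= a)%N -> Y a = (fun=> 0).
Hypothesis deltaD : forall m M, \sum_(m <= s < M) delta 1 s <= D * m.+1%:R `^ (- nu).

(** The coordinates before [a] may be kept as well, since [Y a] ignores them. *)
Lemma local_below a M : local mu Y a M = condE mu (below (a + M)) (Y a).
Proof.
apply: funext => x; rewrite /local /condE; congr mean; apply: funext => y.
rewrite -[LHS](@dY a _ (mix (below (a + M)) x y)); congr (Y a); apply: funext => k.
by rewrite /mix /window /below; case: (leqP a k) => //= ak; case: ifP.
Qed.

Lemma local_cvg e : 0 < e -> exists M0, forall a M, (a < n)%N -> (M0 <= M)%N ->
  mean mu (fun x => `|Y a x - local mu Y a M x|) <= e.
Proof.
move=> e0; elim: (n) => [|p [M0 IH]]; first by exists 0%N.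
have [M1 h1] := condE_below_cvg res (bY p) e0.
exists (maxn M0 M1) => a M; rewrite geq_max ltnS leq_eqVlt.
move=> /predU1P[-> /andP[_ M1M]|ap /andP[M0M _]]; last exact: IH.
by rewrite local_below; apply: h1; rewrite (leq_trans M1M)// leq_addl.
Qed.

(** The remainder is bounded, so its L^(2r) norm is controlled by its L^1 norm,
    which tends to 0. *)
Lemma sum_moment_of_local r (c : R) M0 : (0 < r)%N -> 0 <= c ->
  (forall M, (M0 <= M)%N -> Lp_le mu (2 * r) (fun x => \sum_(0 <= a < n) local mu Y a M x) c) ->
  Lp_le mu (2 * r) (fun x => \sum_(0 <= a < n) Y a x) c.
Proof.
case: r => // r _ c0; have -> : (2 * r.+1 = (2 * r).+2)%N by lia.
move=> hloc; apply: Lp_le_closed => // e e0.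
have /choice[C hC] : forall a, exists C, forall x, `|Y a x| <= C.
  by move=> a; have [_] := bY a.
pose Q := \sum_(0 <= a < n) 2 * `|C a| + 1.
have Q0 : 0 < Q by rewrite ltr_wpDl//; nonneg.
have n0 : 0 < n%:R :> R by rewrite ltr0n; lia.
pose p := (2 * r).+1.
(* [Q] bounds the remainder uniformly; L^1 norms at most [e'] for each index
   make its L^(2r) norm at most [e]. *)
pose e' := e ^+ p.+1 / (n%:R * Q ^+ p).
have e'0 : 0 < e' by rewrite divr_gt0 ?exprn_gt0// mulr_gt0// exprn_gt0.
have [M1 hM1] := local_cvg e'0.
pose M := maxn M0 M1.
have hM := hloc M (leq_maxl _ _).
pose rest x := \sum_(0 <= a < n) (Y a x - local mu Y a M x).
have bl a : bdm (local mu Y a M) by exact: bdm_local.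
have brest : bdm rest by rewrite /rest; bdm_tac.
have -> : (fun x => \sum_(0 <= a < n) Y a x) =
    (fun x => \sum_(0 <= a < n) local mu Y a M x + rest x).
  apply: funext => x; rewrite /rest -big_split/=; apply: eq_bigr => a _.
  by rewrite addrC subrK.
have lC a x : `|local mu Y a M x| <= `|C a|.
  apply: mean_bound; first exact: bdm_mixr.
  by move=> y; apply: le_trans (hC _ _) (ler_norm _).
have restQ x : `|rest x| <= Q.
  apply: (@le_trans _ _ (\sum_(0 <= a < n) 2 * `|C a|)); last by rewrite lerDl.
  apply: le_trans (ler_norm_sum _ _ _) _; apply: ler_sum => a _.
  apply: le_trans (ler_normB _ _) _.
  by have := lC a x; have := le_trans (hC a x) (ler_norm _); lra.
apply: Lp_leD => //; first by bdm_tac.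
rewrite -/p; split; first exact: ltW.
apply: (@le_trans _ _ (Q ^+ p * mean mu (fun x => `|rest x|))).
  rewrite -meanZ; last by bdm_tac.
  apply: mean_le => [||x]; [by bdm_tac..|].
  rewrite exprSr; apply: ler_wpM2r; first by nonneg.
  by apply: lerXn2r; rewrite ?nnegrE// ltW.
have -> : e ^+ p.+1 = Q ^+ p * (n%:R * e').
  by rewrite /e'; field; rewrite expf_neq0 ?gt_eqF.
apply: ler_wpM2l; first by nonneg; exact: ltW.
apply: (@le_trans _ _ (mean mu (fun x => \sum_(0 <= a < n) `|Y a x - local mu Y a M x|))).
  by apply: mean_le => [||x]; [by bdm_tac..|exact: ler_norm_sum].
rewrite mean_sum; last by move=> a; bdm_tac.
rewrite mulr_natl -[n in e' *+ n]subn0 -sumr_const_nat.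
by apply: ler_sum_nat => a /andP[_ an]; apply: hM1 => //; exact: leq_maxr.
Qed.

Lemma bounded_sum_moment_pos K r : 0 < K -> (0 < r)%N ->
  (forall k m M, (0 < k)%N ->
    \sum_(m <= s < M) delta k s <= K * (2 * k%:R) `^ alpha^-1 * m.+1%:R `^ (- nu)) ->
  Lp_le mu (2 * r) (fun x => \sum_(0 <= a < n) Y a x) (moment_bound n r nu alpha K D).
Proof.
move=> K0 r0 deltaK; have K0' := ltW K0.
apply: (@sum_moment_of_local _ _ (2 ^ trunc_log 2 n)) => //.
  exact: moment_bound_ge0.
move=> M LM.
have := @local_sum_moment _ _ _ _ res Y bY mY delta delta0 Ydelta n nu alpha K D
  n2 nu0 alpha0 K0 D0 Y0 deltaK deltaD r M r0 LM.
apply: Lp_le_trans; rewrite /moment_bound /gaussian_const lerD2l.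
set beta := 2^-1 + alpha^-1.
have b0 : 0 <= beta by rewrite /beta addr_ge0// invr_ge0 ltW.
have hq : (trunc_log 2 n).+1%:R `^ beta <= 4 `^ beta * ln n%:R `^ beta.
  have l0 : 0 <= ln n%:R :> R by apply: ln_ge0; rewrite ler1n; lia.
  rewrite -powRM//; apply: ge0_ler_powR; rewrite ?nnegrE//.
    by nonneg.
  exact: trunc_logS_le_ln.
have hG := geometric_sum_Omega n2 nu0.
have g0 : 0 <= geometric_sum nu (trunc_log 2 n).
  have L1 : (0 < trunc_log 2 n)%N by exact: trunc_log_max.
  by apply: le_trans (geometric_sum_ge1 nu L1).
rewrite /weibull_const -/beta.
set c := 3 * _ + _; set m := r%:R `^ _.
have c0 : 0 <= c by rewrite /c; nonneg.
have m0 : 0 <= m by rewrite /m; nonneg.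
have h := ler_pM (powR_ge0 _ _) g0 hq hG.
have h1 : 0 <= c * K * m by nonneg.
have := ler_wpM2l h1 h; lra.
Qed.

(** The case [K = 0] follows by letting [K] decrease to 0. *)
Lemma bounded_sum_moment K r : 0 <= K -> (0 < r)%N ->
  (forall k m M, (0 < k)%N ->
    \sum_(m <= s < M) delta k s <= K * (2 * k%:R) `^ alpha^-1 * m.+1%:R `^ (- nu)) ->
  Lp_le mu (2 * r) (fun x => \sum_(0 <= a < n) Y a x) (moment_bound n r nu alpha K D).
Proof.
move=> K0 r0 deltaK; have r2 : (2 * r = (2 * r).-1.+1)%N by rewrite prednK// muln_gt0.
rewrite r2; apply: Lp_le_closed; first exact: moment_bound_ge0.
move=> e e0; rewrite -r2.
pose c : R := weibull_const alpha * ln n%:R `^ (2^-1 + alpha^-1) * Omega n nu *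
    r%:R `^ Num.max (2^-1 + alpha^-1) 1.
have c0 : 0 <= c.
  by have := weibull_const_ge0 alpha; have := Omega_ge0 n nu => h1 h2; rewrite /c; nonneg.
pose e' := e / (c + 1).
have c1 : 0 < c + 1 by rewrite ltr_wpDl.
have e'0 : 0 < e' by rewrite divr_gt0.
have K'0 : 0 < K + e' by rewrite ltr_wpDl.
apply: (@Lp_le_trans _ _ _ _ _ _ (moment_bound n r nu alpha (K + e') D)); last first.
  apply: bounded_sum_moment_pos => // k m M k0; apply: le_trans (deltaK k m M k0) _.
  rewrite -!mulrA; apply: ler_wpM2r; first by nonneg.
  by rewrite lerDl ltW.
have -> : moment_bound n r nu alpha (K + e') D = moment_bound n r nu alpha K D + c * e'.
  by rewrite /moment_bound /c; ring.
rewrite lerD2l /e' mulrA ler_pdivrMr// mulrC.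
by apply: ler_wpM2l; [exact: ltW|rewrite lerDl].
Qed.

End bounded_sum.

(** * Truncation *)

Section clipping.
Context {R : realType}.
Implicit Types (c y z : R).

Definition clip c y : R := Num.max (- c) (Num.min y c).

Lemma clip_norm_le c y : 0 <= c -> `|clip c y| <= c.
Proof.
move=> c0; rewrite ler_norml /clip; apply/andP; split; first by rewrite le_max lexx.
by rewrite ge_max ge_min lexx orbT andbT; lra.
Qed.

Lemma clip_norm c y : 0 <= c -> `|clip c y| <= `|y|.
Proof.
move=> c0; have h1 := ler_norm y; have h2 := ler_norm (- y); rewrite normrN in h2.
have := normr_ge0 y => h3.
by rewrite ler_norml /clip; case: (leP (- c) (Num.min y c)); case: (leP y c) => yc cy;
  apply/andP; split; lra.
Qed.

Lemma clip_id c y : `|y| <= c -> clip c y = y.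
Proof.
rewrite ler_norml => /andP[h1 h2]; rewrite /clip.
by case: (leP (- c) (Num.min y c)); case: (leP y c) => yc cy; lra.
Qed.

Lemma clip_lip c y z : `|clip c y - clip c z| <= `|y - z|.
Proof.
have h1 := ler_norm (y - z); have h2 := ler_norm (z - y); rewrite distrC in h2.
rewrite ler_norml /clip; case: (leP (- c) (Num.min y c)); case: (leP y c) => yc cy;
  case: (leP (- c) (Num.min z c)); case: (leP z c) => zc cz; apply/andP; split; lra.
Qed.

Lemma measurable_clip d (T : measurableType d) c (f : T -> R) :
  measurable_fun setT f -> measurable_fun setT (fun x => clip c (f x)).
Proof.
by move=> mf; apply: measurable_maxr => //; apply: measurable_minr.
Qed.

Lemma bdm_clip d (T : measurableType d) c (f : T -> R) : 0 <= c ->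
  measurable_fun setT f -> bdm (fun x => clip c (f x)).
Proof.
by move=> c0 mf; split; [exact: measurable_clip|exists c => x; exact: clip_norm_le].
Qed.

Lemma clip_cvg y : clip N%:R y @[N --> \oo] --> y.
Proof.
apply: cvg_near_cst; near=> N; apply: clip_id; near: N.
exact: nbhs_infty_ger.
Unshelve. all: by end_near. Qed.

End clipping.

Section unbounded_sum.
Context {R : realType} d (S : measurableType d) (mu : probability (pasts S) R).
Hypothesis res : resamplable mu.
Variable Y : nat -> pasts S -> R.
Hypothesis iY : forall a, mu.-integrable setT (EFin \o Y a).
Hypothesis mY : forall a, (\int[mu]_x (Y a x)%:E = 0)%E.
Hypothesis dY : forall a, depends (fun k => a <= k)%N (Y a).
Variable delta : nat -> nat -> R.
Hypothesis delta0 : forall k s, 0 <= delta k s.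
Hypothesis Ydelta : forall (N k a s : nat), (0 < k)%N ->
  mean mu (fun x => mean mu (fun y =>
    (clip N%:R (Y a x) - clip N%:R (Y a (mix (predC1 (a + s)%N) x y))) ^+ (2 * k))) <=
    delta k s ^+ (2 * k).
Variables (n : nat) (nu alpha D K : R).
Hypotheses (n2 : (2 <= n)%N) (nu0 : 0 < nu) (alpha0 : 0 < alpha) (D0 : 0 <= D) (K0 : 0 <= K).
Hypothesis Y0 : forall a, (n <= a)%N -> Y a = (fun=> 0).
Hypothesis deltaK : forall k m M, (0 < k)%N ->
    \sum_(m <= s < M) delta k s <= K * (2 * k%:R) `^ alpha^-1 * m.+1%:R `^ (- nu).
Hypothesis deltaD : forall m M, \sum_(m <= s < M) delta 1 s <= D * m.+1%:R `^ (- nu).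

Let measY a : measurable_fun setT (Y a).
Proof. by apply/measurable_EFinP; exact: measurable_int (iY a). Qed.

Let clipY N a x : R := clip N%:R (Y a x) - mean mu (fun x => clip N%:R (Y a x)).

Let bclip N a : bdm (fun x => clip N%:R (Y a x)).
Proof. exact: bdm_clip. Qed.

Let bclipY N a : bdm (clipY N a).
Proof. by rewrite /clipY; bdm_tac. Qed.

Let clipY_moment N r : (0 < r)%N ->
  mean mu (fun x => (\sum_(0 <= a < n) clipY N a x) ^+ (2 * r)) <=
    moment_bound n r nu alpha K D ^+ (2 * r).
Proof.
move=> r0; apply: Lp_le_evenE.
apply: (@bounded_sum_moment _ _ _ _ res (clipY N) _ _ _ delta) => //.
- by move=> a; rewrite /clipY meanB// mean_cst subrr.
- by move=> a x y; rewrite /clipY dY.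
- move=> k a s k0.
  apply: le_trans (coupling_even_le mu (predC1 (a + s)%N) k (bclipY N a)) _.
  rewrite [leLHS](_ : _ = mean mu (fun x => mean mu (fun y =>
    (clip N%:R (Y a x) - clip N%:R (Y a (mix (predC1 (a + s)%N) x y))) ^+ (2 * k)))).
    exact: Ydelta.
  congr mean; apply: funext => x; congr mean; apply: funext => y.
  by rewrite /clipY; congr (_ ^+ _); ring.
- move=> a na; apply: funext => x; rewrite /clipY Y0// mean_cst subrr//.
Qed.

Let mean_clip_cvg a : mean mu (fun x => clip N%:R (Y a x)) @[N --> \oo] --> (0 : R).
Proof.
have mc N : measurable_fun setT (EFin \o (fun x => clip N%:R (Y a x))).
  by apply/measurable_EFinP; exact: measurable_clip.
have [] := @dominated_convergence _ _ _ mu setT measurableT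
  (fun N => EFin \o (fun x => clip N%:R (Y a x))) (EFin \o Y a) (abse \o (EFin \o Y a)).
- exact: mc.
- by apply/measurable_EFinP.
- by apply: aeW => x _; apply: cvg_EFin; [exact: nearW|exact: clip_cvg].
- exact: integrable_abse.
- by apply: aeW => x N _; rewrite /= lee_fin; exact: clip_norm.
move=> _ _; rewrite mY => /fine_cvg; apply: cvg_trans.
by apply: near_eq_cvg; apply: nearW => N.
Qed.

(** The clipped and recentered functions satisfy the hypotheses with the same
    coefficients, and their means tend to 0 by dominated convergence. *)
Lemma sum_moment r : (0 < r)%N ->
  (\int[mu]_x ((\sum_(0 <= a < n) Y a x) ^+ (2 * r))%:E <=
    (moment_bound n r nu alpha K D ^+ (2 * r))%:E)%E.
Proof.
move=> r0; pose f N x := ((\sum_(0 <= a < n) clipY N a x) ^+ (2 * r))%:E.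
have fcvg x : f N x @[N --> \oo] --> ((\sum_(0 <= a < n) Y a x) ^+ (2 * r))%:E.
  apply: cvg_EFin; first exact: nearW.
  apply: (@cvg_comp _ _ _ (fun N => \sum_(0 <= a < n) clipY N a x) (fun y => y ^+ (2 * r)) _
    (nbhs (\sum_(0 <= a < n) Y a x))); last exact: exprn_continuous.
  apply: cvg_big => [|a _]; first by apply: add_continuous.
  rewrite -[Y a x]subr0; apply: cvgB; first exact: clip_cvg.
  exact: mean_clip_cvg.
rewrite (eq_integral (fun x => limn_einf (f ^~ x))); last first.
  by move=> x _; have [-> _] := cvg_limn_einf_sup (fcvg x).
have bf N : bdm (fun x => (\sum_(0 <= a < n) clipY N a x) ^+ (2 * r)) by bdm_tac.
apply: le_trans (fatou mu measurableT _ _) _.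
- by move=> N; apply/measurable_EFinP; have [] := bf N.
- by move=> N x _; rewrite lee_fin even_exp_ge0.
rewrite limn_einf_lim; apply: lime_le; first exact: is_cvg_einfs.
apply: nearW => N; apply: (@le_trans _ _ (\int[mu]_x f N x)%E).
  by apply: ereal_inf_lbound; exists N => //=.
by rewrite /f mean_EFin// lee_fin; exact: clipY_moment.
Qed.

End unbounded_sum.

(** * Laws with independent coordinates *)

Section boxes.
Context d (S : measurableType d) {R : realType}.
Implicit Types (A B : nat -> set S).

Definition box m A : set (pasts S) := [set x | forall k, (k < m)%N -> A k (x k)].

Lemma measurable_coord_preimage k (C : set S) : measurable C ->
  @measurable _ (pasts S) [set x | C (x k)].
Proof.
by move=> mC; have := @measurable_coord _ S k measurableT C mC; rewrite setTI.
Qed.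

Lemma measurable_box m A : (forall k, measurable (A k)) -> measurable (box m A).
Proof.
move=> mA; rewrite (_ : box m A = \bigcap_(k in `I_m) [set x : pasts S | A k (x k)]).
  by apply: bigcap_measurableType => k _; exact: measurable_coord_preimage.
by apply/seteqP; split => x h k; exact: h.
Qed.

Lemma boxI m A B : box m A `&` box m B = box m (fun k => A k `&` B k).
Proof.
apply/seteqP; split => [x [h1 h2] k km|x h]; first by split; [exact: h1|exact: h2].
by split => k km; have [] := h k km.
Qed.

Definition pad m A k : set S := if (k < m)%N then A k else setT.

Lemma box_pad m m' A : (m <= m')%N -> box m A = box m' (pad m A).
Proof.
move=> mm'; apply/seteqP; split => x h k km.
  by rewrite /pad; case: ifP => // /h.
by have := h k (leq_trans km mm'); rewrite /pad km.
Qed.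

Lemma measurable_pad m A : (forall k, measurable (A k)) -> forall k, measurable (pad m A k).
Proof. by move=> mA k; rewrite /pad; case: ifP. Qed.

(** Boxes of even size suffice, since a box can be padded with the whole space;
    interleaved sequences only come with an even number of coordinates. *)
Lemma box_measure_unique (m1 m2 : {measure set (pasts S) -> \bar R}) :
  (m1 setT < +oo)%E ->
  (forall m A, (forall k, measurable (A k)) -> m1 (box (2 * m) A) = m2 (box (2 * m) A)) ->
  forall X : set (pasts S), measurable X -> m1 X = m2 X.
Proof.
move=> fin1 m12 X mX.
pose G := [set X | exists m A, (forall k, measurable (A k)) /\ X = box m A].
apply: (@g_sigma_algebra_measure_unique _ _ (pasts S) G _ (fun=> setT)) => //.
- by move=> _ [m [A [mA ->]]]; exact: measurable_box.
- by move=> _; exists 0%N, (fun=> setT); split => //; apply/seteqP; split.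
- by rewrite bigcup_const//; exists 0%N.
- move=> _ _ [m [A [mA ->]]] [m' [B [mB ->]]].
  rewrite (box_pad A (leq_maxl m m')) (box_pad B (leq_maxr m m')) boxI.
  exists (maxn m m'), (fun k => pad m A k `&` pad m' B k); split => // k.
  by apply: measurableI; exact: measurable_pad.
- move=> _ [m [A [mA ->]]].
  by rewrite (@box_pad m (2 * m)) ?leq_pmull//; apply: m12; exact: measurable_pad.
apply: (@smallest_sub _ _ (@cylinders d S)) mX; first exact: smallest_sigma_algebra.
move=> _ [k _ [C mC <-]]; apply: sub_sigma_algebra; rewrite setTI.
exists k.+1, (fun l => if l == k then C else setT); split => [l|].
  by case: ifP.
apply/seteqP; split => [x Cx l lk|x /(_ k (ltnSn k))]; last by rewrite eqxx.
by case: eqP => // ->.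
Qed.

End boxes.

Section product_laws.
Context d (S : measurableType d) {R : realType}.
Variable rho : set S -> \bar R.
Hypothesis rhoT : rho setT = 1%E.
Implicit Types (A B : nat -> set S).
Local Open Scope ereal_scope.

Definition product_law (Q : set (pasts S) -> \bar R) :=
  forall m A, (forall k, measurable (A k)) ->
    Q (box m A) = \big[mule/1]_(0 <= k < m) rho (A k).

Variable mu : probability (pasts S) R.
Hypothesis mu_law : product_law mu.

Let product_finite : (mu \x mu) setT < +oo.
Proof.
rewrite -setXTT [ltLHS]product_measure1E//.
by rewrite lte_mul_pinfty// ?ge0_fin_numE// (le_lt_trans (probability_le1 _ _))// ltry.
Qed.

Let product_box m A B : (forall k, measurable (A k)) -> (forall k, measurable (B k)) ->
  (mu \x mu) (box m A `*` box m B) =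
  (\big[mule/1]_(0 <= k < m) rho (A k)) * (\big[mule/1]_(0 <= k < m) rho (B k)).
Proof.
move=> mA mB; rewrite [LHS]product_measure1E; [|exact: measurable_box..].
by congr (_ * _); exact: mu_law.
Qed.

(** On a box, the kept and the resampled coordinates contribute the
    two parts of the same product. *)
Lemma product_law_resamplable : resamplable mu.
Proof.
move=> C B mB.
pose phi := fun z : pasts S * pasts S => mix C z.1 z.2.
have mphi : measurable_fun setT phi by exact: measurable_mix.
apply: (@box_measure_unique _ _ _ (pushforward (mu \x mu) phi) mu) mB.
  exact: product_finite.
move=> m A mA; rewrite /pushforward.
pose A1 k := if C k then A k else setT; pose A2 k := if C k then setT else A k.
have mA1 k : measurable (A1 k) by rewrite /A1; case: ifP.
have mA2 k : measurable (A2 k) by rewrite /A2; case: ifP.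
transitivity ((mu \x mu) (box (2 * m) A1 `*` box (2 * m) A2)).
  congr (product_measure1 _ _ _); apply/seteqP; split => [[x y] h|[x y] [h1 h2] k km].
    by split => k km; have := h k km; rewrite /phi /mix /A1 /A2 /=; case: ifP.
  have := h1 k km; have := h2 k km.
  by rewrite /phi /mix /A1 /A2 /=; case: ifP.
transitivity (\big[mule/1]_(0 <= k < 2 * m) rho (A k)); last exact/esym/mu_law.
rewrite product_box// -big_split/=; apply: eq_bigr => k _.
by rewrite /A1 /A2; case: ifP; rewrite rhoT ?mule1 ?mul1e.
Qed.

Definition interleave (x y : pasts S) : pasts S :=
  fun k => if odd k then y k./2 else x k./2.

Lemma measurable_interleave :
  measurable_fun setT (fun z : pasts S * pasts S => interleave z.1 z.2).
Proof.
apply: measurable_pasts => k; rewrite /interleave; case: (odd k).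
  exact: (measurableT_comp (@measurable_coord d S _) (@measurable_snd _ _ (pasts S) (pasts S))).
exact: (measurableT_comp (@measurable_coord d S _) (@measurable_fst _ _ (pasts S) (pasts S))).
Qed.

Lemma big_even_odd (F : nat -> \bar R) m :
  \big[mule/1]_(0 <= k < 2 * m) F k =
  \big[mule/1]_(0 <= k < m) (F (2 * k)%N * F (2 * k).+1).
Proof.
elim: m => [|m IH]; first by rewrite muln0 !big_nil.
by rewrite mulnS !big_nat_recr//= IH muleA.
Qed.

Lemma interleave_law m A : (forall k, measurable (A k)) ->
  (mu \x mu) [set z | box (2 * m) A (interleave z.1 z.2)] =
  \big[mule/1]_(0 <= k < 2 * m) rho (A k).
Proof.
move=> mA; pose A1 k := A (2 * k)%N; pose A2 k := A (2 * k).+1.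
transitivity ((mu \x mu) (box m A1 `*` box m A2)).
  congr (product_measure1 _ _ _); apply/seteqP; split => [[x y] h|[x y] [h1 h2] k km].
    split => k km.
      have := h (2 * k)%N; rewrite /interleave mul2n odd_double doubleK -mul2n.
      by rewrite /A1 /= => H; apply: H; lia.
    have := h (2 * k).+1; rewrite /interleave /= mul2n odd_double uphalf_double -mul2n.
    by rewrite /A2 /= => H; apply: H; lia.
  rewrite /interleave /=; have e := odd_double_half k; rewrite -mul2n in e.
  have [ok|ok] := boolP (odd k).
    have ek : (2 * k./2).+1 = k by rewrite ok in e; lia.
    by have := h2 k./2; rewrite /A2 ek /= => H; apply: H; lia.
  have ek : (2 * k./2)%N = k by rewrite (negbTE ok) in e; lia.
  by have := h1 k./2; rewrite /A1 ek /= => H; apply: H; lia.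
rewrite product_box; [|by move=> k; exact: mA..].
by rewrite big_even_odd big_split.
Qed.

(** Interleaving is a measurable bijection, so the equality of two laws on pairs
    can be tested on boxes of interleaved sequences. *)
Lemma joint_law d0 (T : measurableType d0) (P : probability T R) (X X' : T -> pasts S) :
  measurable_fun setT X -> measurable_fun setT X' ->
  product_law (fun E : set (pasts S) => P [set w | E (interleave (X w) (X' w))]) ->
  forall B : set (pasts S * pasts S), measurable B ->
    P [set w | B (X w, X' w)] = (mu \x mu) B.
Proof.
move=> mX mX' law B mB.
pose Z w := (X w, X' w); pose phi z := @interleave z.1 z.2.
have mZ : measurable_fun setT Z by exact: measurable_fun_pair.
have mphi : measurable_fun setT phi by exact: measurable_interleave.
pose psi (x : pasts S) : pasts S * pasts S :=
  ((fun k => x (2 * k)%N) : pasts S, (fun k => x (2 * k).+1) : pasts S).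
have mpsi : measurable_fun setT psi.
  by apply: measurable_fun_pair; apply: measurable_pasts => k; exact: measurable_coord.
have phiK : cancel phi psi.
  move=> [x y]; rewrite /psi /phi /interleave /=; congr pair; apply: funext => k.
    by rewrite mul2n odd_double doubleK.
  by rewrite mul2n /= odd_double uphalf_double.
have mB' : measurable (psi @^-1` B) by rewrite -[X in measurable X]setTI; exact: mpsi.
have E : pushforward P (phi \o Z) (psi @^-1` B) = pushforward (mu \x mu) phi (psi @^-1` B).
  apply: box_measure_unique mB' => [|mphiZ|mphiZ m A mA].
  - exact: measurableT_comp.
  - by apply: (@le_lt_trans _ _ 1); [apply: probability_le1; exact: measurableT|exact: ltry].
  transitivity (\big[mule/1]_(0 <= k < 2 * m) rho (A k)); first exact: law.
  by rewrite -interleave_law.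
transitivity (pushforward P (phi \o Z) (psi @^-1` B)).
  by congr (P _); apply/seteqP; split => w; rewrite /preimage /= phiK.
rewrite E; congr (product_measure1 _ _ _).
by apply/seteqP; split => w; rewrite /preimage /= phiK.
Qed.

End product_laws.

Section independent_sequences.
Context d d' (T : measurableType d) (S : measurableType d') (R : realType).
Variables (P : probability T R) (I : choiceType) (X : I -> {RV P >-> S}).
Local Open Scope ereal_scope.

(** The left inverse [g] of the enumeration [f] turns events indexed by
    positions into events indexed by [I]. *)
Lemma mutually_independent_seq (f : nat -> I) (g : I -> nat) m (A : nat -> set S) :
  cancel f g -> mutually_independent X -> (forall k, measurable (A k)) ->
  P [set w | forall k, (k < m)%N -> A k (X (f k) w)] =
  \big[mule/1]_(0 <= k < m) P (X (f k) @^-1` A k).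
Proof.
move=> fK ind mA; pose s := [seq f k | k <- iota 0 m].
have us : uniq s by rewrite map_inj_uniq ?iota_uniq//; exact: can_inj fK.
have := ind [fset x in s]%fset (A \o g) (fun i => mA (g i)).
rewrite (perm_big s)/=; last first.
  apply: uniq_perm; [exact: fset_uniq|exact: us|].
  by move=> i; rewrite in_fset.
rewrite big_map; under eq_bigr do rewrite fK.
rewrite /index_iota subn0 => <-; congr (P _); apply/seteqP; split => w h.
  move=> i /=; rewrite in_fset => /mapP[k]; rewrite mem_iota => /andP[_ km] ->.
  by rewrite /preimage /= fK; exact: h.
move=> k km; have := h (f k); rewrite /preimage /= fK; apply.
by rewrite in_fset map_f// mem_iota.
Qed.

End independent_sequences.

(** * The law of the innovations *)

Section law_of_the_innovations.
Context d d' (T : measurableType d) (S : measurableType d') (R : realType).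
Variables (P : probability T R) (eps eps' : int -> {RV P >-> S}).
Hypothesis iid_eps : iid (innovations eps eps').
Variable n : nat.
Local Open Scope ereal_scope.

Let rho (B : set S) : \bar R := P (eps 0%Z @^-1` B).

Let rhoT : rho setT = 1. Proof. by rewrite /rho preimage_setT probability_setT. Qed.

Let rhoE i (B : set S) : measurable B -> P (innovations eps eps' i @^-1` B) = rho B.
Proof. by move=> mB; have := iid_eps.2 i (inl 0%Z) B mB. Qed.

Lemma measurable_past (e : int -> {RV P >-> S}) i :
  measurable_fun setT (past e i : T -> pasts S).
Proof. by apply: measurable_pasts => k; rewrite /past; exact: measurable_funPT. Qed.

Definition past_rv : {mfun T >-> pasts S} :=
  HB.pack_for {mfun T >-> pasts S} (past eps n%:Z : T -> pasts S)
    (isMeasurableFun.Build _ _ _ _ _ (measurable_past eps n%:Z)).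

Definition past_law : probability (pasts S) R := distribution P past_rv.

Let past_product_law : product_law rho past_law.
Proof.
move=> m A mA.
pose f k : (int + int)%type := inl (n%:Z - k%:Z)%R.
pose g (i : (int + int)%type) := match i with inl z => absz (n%:Z - z)%R | inr _ => 0%N end.
have fK : cancel f g by move=> k; rewrite /f /g /=; lia.
have := mutually_independent_seq m fK iid_eps.1 mA.
by under eq_bigr do rewrite rhoE//.
Qed.

Lemma past_law_resamplable : resamplable past_law.
Proof. exact: (product_law_resamplable rhoT past_product_law). Qed.

(** The interleaved pasts enumerate distinct elements of the family of all the
    innovations. *)
Lemma past_joint_law (B : set (pasts S * pasts S)) : measurable B ->
  P [set w | B (past eps n%:Z w, past eps' n%:Z w)] = (past_law \x past_law) B.
Proof.
move=> mB; apply: (joint_law past_product_law) => //.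
- exact: measurable_past.
- exact: measurable_past.
move=> m A mA.
pose f k : (int + int)%type :=
  if odd k then inr (n%:Z - (k./2)%:Z)%R else inl (n%:Z - (k./2)%:Z)%R.
pose g (i : (int + int)%type) :=
  match i with inl z => (2 * absz (n%:Z - z)%R)%N | inr z => (2 * absz (n%:Z - z)%R).+1 end.
have fK : cancel f g.
  move=> k; rewrite /f /g; have e := odd_double_half k; rewrite -mul2n in e.
  by case: ifP => ok; rewrite ok in e; lia.
have := mutually_independent_seq m fK iid_eps.1 mA.
under [X in _ = X -> _]eq_bigr do rewrite rhoE//.
move=> <-; congr (P _); apply/seteqP; split => w h k km.
  by have := h k km; rewrite /interleave /f /past /=; case: ifP.
by have := h k km; rewrite /interleave /f /past /=; case: ifP.
Qed.

Lemma mean_past_pair (F : pasts S * pasts S -> R) : bdm F ->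
  mean past_law (fun x => mean past_law (fun y => F (x, y))) =
  mean P (fun w => F (past eps n%:Z w, past eps' n%:Z w)).
Proof.
move=> bF; pose Z w : pasts S * pasts S := (past eps n%:Z w, past eps' n%:Z w).
have mZ : measurable_fun setT Z by apply: measurable_fun_pair; exact: measurable_past.
rewrite mean_pair//; rewrite /mean /Rintegral; congr fine.
have mF : measurable_fun setT (EFin \o F) by apply/measurable_EFinP; case: bF.
transitivity (\int[pushforward P Z]_z (EFin \o F) z).
  by apply: eq_measure_integral => // B mB _; exact: (esym (past_joint_law mB)).
rewrite integral_pushforward//.
by apply: bdm_integrable; exact: bdm_comp bF mZ.
Qed.

End law_of_the_innovations.

(** * The process read backwards in time, and its dependence coefficients *)

Section reversed_process.
Context d d' (T : measurableType d) (S : measurableType d') (R : realType).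
Variables (P : probability T R) (eps eps' : int -> {RV P >-> S}).
Variables (n q : nat) (g : nat -> 'I_q -> {mfun pasts S >-> R}) (j : 'I_q).

Definition shift a (x : pasts S) : pasts S := fun k => x (k + a)%N.

Lemma measurable_shift a : measurable_fun setT (shift a).
Proof. by apply: measurable_pasts => k; exact: measurable_coord. Qed.

(** The process at time [n - a], as a function of the past at time [n]. *)
Definition reversed a (x : pasts S) : R := if (a < n)%N then g (n - a)%N j (shift a x) else 0.

Lemma measurable_rev a : measurable_fun setT (reversed a).
Proof.
rewrite /reversed; case: (a < n)%N; last exact: measurable_cst.
by apply: measurableT_comp; [exact: measurable_funPT|exact: measurable_shift].
Qed.

Lemma depends_rev a : depends (fun k => a <= k)%N (reversed a).
Proof.
move=> x y; rewrite /reversed; case: ifP => // _.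
suff -> : shift a (mix (fun k => a <= k)%N x y) = shift a x by [].
by apply: funext => k; rewrite /shift /mix leq_addl.
Qed.

Lemma rev_causal a w : (a < n)%N ->
  reversed a (past eps n%:Z w) = causal eps g (n - a) j w.
Proof.
move=> an; rewrite /reversed an /causal.
suff -> : shift a (past eps n%:Z w) = past eps (n - a)%N%:Z w by [].
apply: funext => k; rewrite /shift /past.
by have -> : (n%:Z - (k + a)%N%:Z = (n - a)%N%:Z - k%:Z)%R by lia.
Qed.

Lemma rev_coupled a s w : (a < n)%N ->
  reversed a (mix (predC1 (a + s)%N) (past eps n%:Z w) (past eps' n%:Z w)) =
  coupled eps eps' g (n - a) s j w.
Proof.
move=> an; rewrite /reversed an /coupled.
suff -> : shift a (mix (predC1 (a + s)%N) (past eps n%:Z w) (past eps' n%:Z w)) =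
  coupled_past eps eps' (n - a)%N%:Z s w by [].
apply: funext => k; rewrite /shift /mix /past /coupled_past /= addnC eqn_add2l.
have -> : (n%:Z - (a + k)%N%:Z = (n - a)%N%:Z - k%:Z)%R by lia.
by case: eqP => [->|_].
Qed.

Lemma sum_rev w : \sum_(0 <= a < n) reversed a (past eps n%:Z w) =
  \sum_(1 <= i < n.+1) causal eps g i j w.
Proof.
rewrite [RHS]big_nat_rev/= big_add1/=; apply: eq_big_nat => a /andP[_ an].
by rewrite rev_causal//; congr (causal _ _ _ _ _); lia.
Qed.

End reversed_process.

Section dependence_coefficients.
Context d d' (T : measurableType d) (S : measurableType d') (R : realType).
Variables (P : probability T R) (eps eps' : int -> {RV P >-> S}).
Variables (n q : nat) (g : nat -> 'I_q -> {mfun pasts S >-> R}).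
Local Open Scope ereal_scope.
Notation delta := (delta eps eps' n g).
Notation dep_norm := (dep_norm eps eps' n g).

Lemma delta_ge0 s r j : 0 <= delta s r j.
Proof. exact: bigmax_ge_id. Qed.

Lemma Lnorm_le_delta s r j i : (1 <= i <= n)%N ->
  'N[P]_r%:E[EFin \o (fun w => causal eps g i j w - coupled eps eps' g i s j w)%R] <= delta s r j.
Proof. by move=> hi; apply: le_bigmax_seq => //; rewrite mem_index_iota ltnS. Qed.

Lemma coord_le_dep_norm r nu j : coord_dep_norm eps eps' n g r nu j <= dep_norm r nu.
Proof. by apply: le_bigmax_seq => //; rewrite mem_index_enum. Qed.

(** Only finite partial sums are used, so that the coefficients can be handled
    as real numbers. *)
Lemma sum_delta_le r nu j (c : R) m M : dep_norm r nu <= c%:E ->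
  \sum_(m <= s < M) delta s r j <= (c * m.+1%:R `^ (- nu))%:E.
Proof.
move=> hc; apply: (@le_trans _ _ (Delta eps eps' n g m r j)).
  by apply: nneseries_lim_ge => s _ _; exact: delta_ge0.
have m0 : (0 < m.+1%:R `^ nu :> R)%R by rewrite powR_gt0.
rewrite powRN mulrC EFinM lee_pdivlMl//.
apply: le_trans hc; apply: le_trans (coord_le_dep_norm _ _ j).
by apply: ereal_sup_ubound; exists m.
Qed.

Lemma delta_fin r nu j c s : dep_norm r nu <= c%:E -> delta s r j \is a fin_num.
Proof.
move=> hc; rewrite ge0_fin_numE ?delta_ge0//.
have := sum_delta_le j s s.+1 hc; rewrite big_nat1 => /le_lt_trans; apply.
exact: ltry.
Qed.

Lemma sum_fine_delta_le r nu j (c : R) m M : dep_norm r nu <= c%:E ->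
  (\sum_(m <= s < M) fine (delta s r j) <= c * m.+1%:R `^ (- nu))%R.
Proof.
move=> hc; rewrite -lee_fin -sumEFin; apply: le_trans (sum_delta_le j m M hc).
apply: eq_leW; apply: eq_bigr => s _.
by rewrite fineK//; exact: delta_fin hc.
Qed.

Lemma coupling_moment_le r nu j (c : R) i s k : dep_norm r nu <= c%:E ->
  r = (2 * k)%:R -> (0 < k)%N -> (1 <= i <= n)%N ->
  \int[P]_w ((causal eps g i j w - coupled eps eps' g i s j w) ^+ (2 * k))%:E <=
    (fine (delta s r j) ^+ (2 * k))%:E.
Proof.
move=> hc rk k0 hi; have r0 : (r != 0)%R by rewrite rk pnatr_eq0 muln_eq0; lia.
have rp : (0 <= r)%R by rewrite rk.
apply: (@le_trans _ _ ((delta s r j) `^ r)).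
  apply: (@le_trans _ _ ('N[P]_r%:E[EFin \o
      (fun w => causal eps g i j w - coupled eps eps' g i s j w)%R] `^ r)).
    rewrite poweR_Lnorm//; apply: eq_leW.
    apply: eq_integral => w _ /=.
    by rewrite rk powR_mulrn ?norm_even_exp// normr_ge0.
  have in0y (x : \bar R) : 0 <= x -> x \in `[0, +oo] by move=> x0; rewrite in_itv/= x0 leey.
  apply: gt0_ler_poweR => //; [apply/in0y/Lnorm_ge0|exact/in0y/delta_ge0|].
  exact: Lnorm_le_delta.
rewrite -{1}(fineK (delta_fin j s hc)) poweR_EFin rk powR_mulrn//.
by rewrite fine_ge0// delta_ge0.
Qed.

Lemma dep_norm_le_psi alpha nu (K r : R) : (2 <= r)%R ->
  psi_dep_norm eps eps' n g alpha nu <= K%:E ->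
  dep_norm r nu <= (K * r `^ alpha^-1)%:E.
Proof.
move=> r2 hK; have r0 : (0 < r `^ (- alpha^-1))%R by rewrite powR_gt0//; lra.
rewrite (_ : (K * r `^ alpha^-1)%R = ((r `^ (- alpha^-1))^-1 * K)%R); last first.
  by rewrite powRN invrK mulrC.
rewrite EFinM lee_pdivlMl//; apply: le_trans hK.
by apply: ereal_sup_ubound; exists r.
Qed.

Lemma dep_norm_ge0 r nu : 0 <= dep_norm r nu.
Proof. exact: bigmax_ge_id. Qed.

End dependence_coefficients.

(** * Moments of the partial sums of the process *)

Section causal_sum.
Context d d' (T : measurableType d) (S : measurableType d') (R : realType).
Variables (P : probability T R) (eps eps' : int -> {RV P >-> S}).
Variables (n q : nat) (g : nat -> 'I_q -> {mfun pasts S >-> R}).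
Variables (alpha nu K : R).
Hypothesis iid_eps : iid (innovations eps eps').
Hypotheses (n2 : (2 <= n)%N) (alpha0 : 0 < alpha) (nu0 : 0 < nu).
Hypothesis centered : forall (i : nat) (j : 'I_q), (1 <= i <= n)%N ->
  P.-integrable setT (EFin \o causal eps g i j) /\
  ('E_P[causal eps g i j] = 0)%E.
Hypothesis psi_le : (psi_dep_norm eps eps' n g alpha nu <= K%:E)%E.

Let norm_le k : (0 < k)%N ->
  (dep_norm eps eps' n g (2 * k)%:R nu <= (K * (2 * k%:R) `^ alpha^-1)%:E)%E.
Proof.
by move=> k0; rewrite natrM; apply: dep_norm_le_psi => //; rewrite ler_peMr// ler1n.
Qed.

Lemma dep_norm2_fin : dep_norm eps eps' n g 2 nu \is a fin_num.
Proof.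
rewrite ge0_fin_numE ?dep_norm_ge0//.
by apply: le_lt_trans (norm_le (k := 1) isT) _; exact: ltry.
Qed.

Lemma psi_bound_ge0 : 0 <= K.
Proof.
have := le_trans (dep_norm_ge0 eps eps' n g (2 * 1)%:R nu) (norm_le (k := 1) isT).
by rewrite lee_fin pmulr_lge0// powR_gt0// mulr_gt0.
Qed.

Let D := fine (dep_norm eps eps' n g 2 nu).

Let X := past_rv eps n.
Let mu := past_law eps n.

(** The function of the past at time [n] that computes the sum is centered,
    depends on the right coordinates and has the coupling coefficients of the
    process; its moments under the law of the past are those of the sum. *)
Lemma causal_sum_moment j r : (0 < r)%N ->
  (\int[P]_w ((\sum_(1 <= i < n.+1) causal eps g i j w) ^+ (2 * r))%:E <=
    (moment_bound n r nu alpha K D ^+ (2 * r))%:E)%E.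
Proof.
move=> r0; pose Y := reversed n g j; pose dl k s := fine (delta eps eps' n g s (2 * k)%:R j).
have mEY a : measurable_fun setT (EFin \o Y a) by apply/measurable_EFinP; exact: measurable_rev.
have YX a : (a < n)%N -> (EFin \o Y a) \o X = EFin \o causal eps g (n - a) j.
  by move=> an; apply: funext => w /=; congr EFin; exact: rev_causal.
have Y0 a : (n <= a)%N -> Y a = (fun=> 0).
  by move=> na; apply: funext => x; rewrite /Y /reversed ltnNge na.
have iYX a : P.-integrable setT ((EFin \o Y a) \o X).
  have [an|na] := ltnP a n; last by rewrite Y0//; exact: integrable0.
  by rewrite YX//; have [|] := centered (i := n - a) j; first by lia.
rewrite [leLHS](_ : _ = (\int[mu]_x ((\sum_(0 <= a < n) Y a x) ^+ (2 * r))%:E)%E); last first.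
  rewrite ge0_integral_distribution.
  - by apply: eq_integral => w _ /=; rewrite -sum_rev.
  - apply/measurable_EFinP/measurable_funX; apply: measurable_sum => a.
    exact: measurable_rev.
  - by move=> x; rewrite lee_fin even_exp_ge0.
apply: (@sum_moment _ _ _ mu (past_law_resamplable iid_eps n) Y _ _ _ dl) => //.
- by move=> a; apply: integrable_pushforward => //; exact: iYX.
- move=> a; rewrite integral_distribution; [|exact: mEY|exact: iYX].
  have [an|na] := ltnP a n; last by rewrite Y0//= integral0.
  rewrite YX//; have [|_] := centered (i := n - a) j; first by lia.
  by rewrite unlock.
- by move=> a; exact: depends_rev.
- by move=> k s; rewrite fine_ge0// delta_ge0.
- move=> N k a s k0.
  pose F (z : pasts S * pasts S) := (clip N%:R (Y a z.1) -
    clip N%:R (Y a (mix (predC1 (a + s)%N) z.1 z.2))) ^+ (2 * k).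
  have bF : bdm F.
    have bc : bdm (fun x => clip N%:R (Y a x)) by apply: bdm_clip => //; exact: measurable_rev.
    apply/bdmX/bdmB; first by apply: (bdm_comp bc); exact: measurable_fst.
    by apply: (bdm_comp bc); exact: measurable_mix.
  rewrite [leLHS](mean_past_pair iid_eps n bF).
  have [an|na] := ltnP a n; last first.
    rewrite /F Y0//; under [X in mean _ X]eq_fun do rewrite subrr expr0n.
    rewrite mean_cst (_ : (2 * k == 0)%N = false) ?even_exp_ge0//; lia.
  have hi : (1 <= n - a <= n)%N by lia.
  have bFp : bdm (fun w => F (past eps n%:Z w, past eps' n%:Z w)).
    by apply: (bdm_comp bF); apply: measurable_fun_pair; exact: measurable_past.
  rewrite -lee_fin -mean_EFin//.
  apply: le_trans (coupling_moment_le j s (norm_le k0) (erefl _) k0 hi).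
  apply: ge0_le_integral => //.
  + by move=> w _; rewrite lee_fin even_exp_ge0.
  + by apply/measurable_EFinP; case: bFp.
  + rewrite (_ : (fun w => _) = EFin \o (fun w => (Y a (past eps n%:Z w) -
        Y a (mix (predC1 (a + s)%N) (past eps n%:Z w) (past eps' n%:Z w))) ^+ (2 * k))).
      have mY : measurable_fun setT (Y a) by exact: measurable_rev.
      apply/measurable_EFinP/measurable_funX/measurable_funB.
        exact: (measurableT_comp mY (measurable_past eps n%:Z)).
      have mp := measurable_fun_pair (measurable_past eps n%:Z) (measurable_past eps' n%:Z).
      exact: (measurableT_comp mY (measurableT_comp (measurable_mix (predC1 (a + s)%N)) mp)).
    by apply: funext => w /=; rewrite /Y rev_causal// rev_coupled.
  + move=> w _; rewrite lee_fin /F /Y /= rev_causal// rev_coupled//.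
    rewrite -norm_even_exp -[leRHS]norm_even_exp; apply: lerXn2r; rewrite ?nnegrE//.
    exact: clip_lip.
- by rewrite fine_ge0// dep_norm_ge0.
- exact: psi_bound_ge0.
- by move=> k m M k0; apply: sum_fine_delta_le; exact: norm_le.
- by move=> m M; apply: sum_fine_delta_le; rewrite muln1 fineK//; exact: dep_norm2_fin.
Qed.

End causal_sum.

(** * The tail bound *)

Section tail_of_a_moment.
Context {R : realType} d (T : measurableType d) (P : probability T R).
Local Open Scope ereal_scope.

(** Markov's inequality for the 2r-th power. When [b = 0] the function
    vanishes almost everywhere. *)
Lemma moment_tail (f : T -> R) (b : R) r : measurable_fun setT f -> (0 <= b)%R -> (0 < r)%N ->
  \int[P]_w (f w ^+ (2 * r))%:E <= (b ^+ (2 * r))%:E ->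
  P [set w | (expR 1 * b < `|f w|)%R] <= (expR (- (2 * r)%:R))%:E.
Proof.
move=> mf b0 r0 fb; set A := [set w | _].
have mA : measurable A.
  have := @measurable_fun_ltr _ _ _ setT (cst (expR 1 * b)%R) (fun w => `|f w|%R).
  move=> /(_ (measurable_cst _) _ measurableT [set true]).
  rewrite setTI (_ : _ @^-1` _ = A); last by apply/seteqP; split => w //=.
  by apply => //; exact: measurableT_comp.
have mfr : measurable_fun setT (fun w => (f w ^+ (2 * r))%:E).
  by apply/measurable_EFinP; exact: measurable_funX.
move: b0; rewrite le_eqVlt => /predU1P[b0|b0].
  rewrite -b0 expr0n in fb; have r2 : (2 * r == 0)%N = false by lia.
  rewrite r2 in fb.
  have f0 : \int[P]_w `|(f w ^+ (2 * r))%:E| = 0.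
    apply/eqP; rewrite eq_le integral_ge0 ?andbT//; apply: le_trans fb.
    apply: eq_leW; apply: eq_integral => w _.
    by rewrite gee0_abs// lee_fin even_exp_ge0.
  have /ae_eq_integral_abs H := f0.
  have [N [mN N0 subN]] := H measurableT mfr.
  apply: (@le_trans _ _ 0); last by rewrite lee_fin expR_ge0.
  rewrite -N0; apply: le_measure; rewrite ?inE//.
  move=> w; rewrite /A /= -b0 mulr0 => fw; apply: subN => /= /(_ I) /eqP.
  by rewrite eqe expf_eq0 => /andP[_ /eqP fw0]; rewrite fw0 normr0 ltxx in fw.
have b0' := ltW b0.
pose c : R := ((expR 1 * b) ^+ (2 * r))%R.
have c0 : (0 < c)%R by rewrite exprn_gt0// mulr_gt0// expR_gt0.
have h : c%:E * P A <= (b ^+ (2 * r))%:E.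
  apply: le_trans fb.
  rewrite -(setIT A) -integral_indic// -ge0_integralZl//; last 2 first.
  - by apply/measurable_EFinP; exact: measurable_indic.
  - by rewrite lee_fin ltW.
  apply: ge0_le_integral => //.
  - by move=> w _; rewrite -EFinM lee_fin mulr_ge0// ltW.
  - by apply: measurable_funeM; apply/measurable_EFinP; exact: measurable_indic.
  - move=> w _; rewrite -EFinM lee_fin indicE.
    have [|_] := boolP (w \in A); last by rewrite mulr0 even_exp_ge0.
    rewrite inE /A /= mulr1 => fw; rewrite /c -[leRHS]norm_even_exp.
    by apply: lerXn2r; rewrite ?nnegrE ?mulr_ge0 ?expR_ge0// ltW.
have -> : expR (- (2 * r)%:R) = (c^-1 * b ^+ (2 * r))%R.
  rewrite /c exprMn invfM -mulrA mulVf ?expf_neq0 ?gt_eqF// mulr1.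
  by rewrite -expRM_natl mulr1 expRN.
by rewrite EFinM lee_pdivlMl.
Qed.

End tail_of_a_moment.

Section union_bound.
Context {R : realType} d (T : measurableType d) (P : probability T R).

Lemma union_tail q (F : 'I_q.+1 -> T -> R) (c p : R) :
  (forall j, measurable_fun setT (F j)) ->
  (forall j, (P [set w | (c < F j w)%R] <= p%:E)%E) ->
  ((1 - q.+1%:R * p)%:E <= P [set w | forall j, (F j w <= c)%R])%E.
Proof.
move=> mF tail.
pose A i := [set w | c < F (inord i) w].
have mA i : measurable (A i).
  have := @measurable_fun_ltr _ _ _ setT (cst c) (F (inord i)) (measurable_cst _) (mF _).
  move=> /(_ measurableT [set true]); rewrite setTI (_ : _ @^-1` _ = A i); first exact.
  by apply/seteqP; split => w.
have -> : [set w | forall j, F j w <= c] = ~` \big[setU/set0]_(i < q.+1) A i.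
  apply/seteqP; split => [w h|w]; rewrite /= -bigcup_mkord.
    by move=> [i _]; rewrite /A /= ltNge h.
  by move=> h j; rewrite leNgt; apply/negP => cj; apply: h;
    exists (nat_of_ord j); [exact: ltn_ord|rewrite /A /= inord_val].
rewrite probability_setC; last by apply: bigsetU_measurable.
rewrite EFinB leeB//; apply: (le_trans (Boole_inequality P (fun i _ => mA i))).
apply: (@le_trans _ _ (\sum_(i < q.+1) p%:E)%E); first by apply: lee_sum => i _; exact: tail.
by rewrite sumEFin lee_fin sumr_const card_ord mulr_natl.
Qed.

End union_bound.

Section orders.
Context {R : realType}.

Lemma moment_order (u : R) : 2 <= u ->
  exists2 r : nat, (0 < r)%N & u / 2 <= r%:R <= u.
Proof.
move=> u2; have u0 : 0 <= u / 2 by lra.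
exists (Num.truncn (u / 2)).+1 => //.
have /andP[h1 h2] := truncn_itv u0.
by rewrite ltW//= -natr1; lra.
Qed.

Lemma inv_T1_s (alpha : R) : 0 < alpha -> (T1 (s_ alpha))^-1 = Num.max (2^-1 + alpha^-1) 1.
Proof.
move=> a0; rewrite /T1 /s_; set b := 2^-1 + _.
have b0 : 0 < b by rewrite /b addr_gt0// invr_gt0.
have [b1|b1] := leP b 1.
  by rewrite min_r ?invr1// -[leLHS]invr1 lef_pV2 ?posrE.
by rewrite min_l ?invrK// -[leRHS]invr1 lef_pV2 ?posrE// ltW.
Qed.

End orders.

Theorem theorem7 (R : realType) :
  exists B C : R -> R,
  forall (d d' : measure_display) (T : measurableType d) (S : measurableType d')
    (P : probability T R) (eps eps' : int -> {RV P >-> S})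
    (n q : nat) (g : nat -> 'I_q -> {mfun pasts S >-> R})
    (alpha nu K : R),
  iid (innovations eps eps') ->
  (2 <= n)%N -> (1 <= q)%N ->
  0 < alpha -> 0 < nu ->
  (forall (i : nat) (j : 'I_q), (1 <= i <= n)%N ->
     P.-integrable setT (EFin \o causal eps g i j) /\
     ('E_P[causal eps g i j] = 0)%E) ->
  (psi_dep_norm eps eps' n g alpha nu <= K%:E)%E ->
  forall t : R, 0 <= t ->
  ((1 - 8 * expR (- t))%:E <=
   P [set w |
     (\big[Num.max/0%R]_(j < q) `|\sum_(1 <= i < n.+1) causal eps g i j w|)%:E <=
     (expR 1 * Num.sqrt n%:R)%:E * dep_norm eps eps' n g 2 nu *
       (B nu * Num.sqrt (t + ln q.+1%:R))%:E +
     (C alpha * K * ln n%:R `^ (s_ alpha)^-1 * Omega n nu *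
       (t + ln q.+1%:R) `^ (T1 (s_ alpha))^-1)%:E])%E.
Proof.
exists gaussian_const, (fun alpha => expR 1 * weibull_const alpha).
move=> d d' T S P eps eps' n q g alpha nu K iid_eps n2 q1 alpha0 nu0 centered psi_le t t0.
have l2 := @ln2_ge_half R.
have K0 := psi_bound_ge0 psi_le.
have Dfin := dep_norm2_fin psi_le.
have Dge := dep_norm_ge0 eps eps' n g 2 nu.
case: q q1 g centered psi_le Dfin Dge => // q _ g centered psi_le Dfin Dge.
set u := t + ln q.+2%:R.
(* The claim is void unless [t > log 8], and then [u >= 4 log 2 >= 2], which
   leaves room for an integer between [u / 2] and [u]. *)
have [t8|t8] := leP 1 (8 * expR (- t)).
  by apply: le_trans (measure_ge0 _ _); rewrite lee_fin subr_le0.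
have q2 : 2 <= q.+2%:R :> R by rewrite ler_nat.
have u2 : 2 <= u.
  have t3 : 3 * ln 2 < t.
    rewrite -ltr_expR -[expR t]invrK -expRN -[ltLHS]invrK ltf_pV2 ?posrE ?invr_gt0 ?expR_gt0//.
    rewrite (_ : 3 * ln 2 = ln (2 ^+ 3)); last by rewrite lnXn// mulr_natl.
    by rewrite lnK ?posrE ?exprn_gt0//; lra.
  have : ln 2 <= ln q.+2%:R :> R by rewrite ler_ln ?posrE ?ltr0n.
  by rewrite /u; lra.
have u0 : 0 <= u by lra.
have [r r0 /andP[ur ru]] := moment_order u2.
have r0' : 0 <= r%:R :> R by [].
pose D := fine (dep_norm eps eps' n g 2 nu).
have DE : dep_norm eps eps' n g 2 nu = D%:E by rewrite fineK.
have D0 : 0 <= D by rewrite fine_ge0.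
pose c : R := expR 1 * Num.sqrt n%:R * D * (gaussian_const nu * Num.sqrt u) +
  expR 1 * weibull_const alpha * K * ln n%:R `^ (s_ alpha)^-1 * Omega n nu *
    u `^ (T1 (s_ alpha))^-1.
have G0 := gaussian_const_ge0 nu0; have W0 := weibull_const_ge0 alpha.
have O0 := Omega_ge0 n nu.
have c0 : 0 <= c by rewrite /c; nonneg.
(* [c] is the right-hand side of the claim; dividing it by [e] leaves a bound
   on the norm of the sum, since [r <= u]. *)
pose b := c / expR 1.
have b0 : 0 <= b by rewrite /b; nonneg.
have bc : expR 1 * b = c by rewrite /b mulrC divfK// gt_eqF// expR_gt0.
have mb : moment_bound n r nu alpha K D <= b.
  rewrite /b ler_pdivlMr ?expR_gt0// /moment_bound /c inv_T1_s// /s_ invrK mulrDl.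
  apply: lerD.
    rewrite [leLHS](_ : _ =
      expR 1 * Num.sqrt n%:R * D * (gaussian_const nu * Num.sqrt r%:R)); last by ring.
    apply: ler_wpM2l; first by nonneg.
    by apply: ler_wpM2l => //; exact: ler_wsqrtr.
  set p := Num.max _ 1; set l := ln _ `^ _.
  rewrite [leLHS](_ : _ =
    expR 1 * weibull_const alpha * K * l * Omega n nu * r%:R `^ p); last by ring.
  apply: ler_wpM2l; first by rewrite /l; nonneg.
  by apply: ge0_ler_powR; rewrite ?nnegrE// /p le_max ler01 orbT.
have mS j : measurable_fun setT (fun w => \sum_(1 <= i < n.+1) causal eps g i j w).
  apply: measurable_sum => i.
  exact: (measurableT_comp (measurable_funPT (g i j)) (measurable_past eps i%:Z)).
have tail j : (P [set w | (c < `|\sum_(1 <= i < n.+1) causal eps g i j w|)%R]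
    <= (expR (- u))%:E)%E.
  rewrite -bc; apply: le_trans (moment_tail (mS j) b0 r0 _) _.
    apply: le_trans (causal_sum_moment iid_eps n2 alpha0 nu0 centered psi_le j r0) _.
    rewrite lee_fin; apply: lerXn2r; rewrite ?nnegrE//; exact: moment_bound_ge0.
  by rewrite lee_fin ler_expR lerN2 natrM; lra.
have mabs j : measurable_fun setT (fun w => `|\sum_(1 <= i < n.+1) causal eps g i j w|).
  exact: measurableT_comp.
rewrite [X in P X](_ : _ = [set w | forall j, `|\sum_(1 <= i < n.+1) causal eps g i j w| <= c]);
  last first.
  rewrite DE -!EFinM -EFinD -/c; apply/seteqP; split => w /=; rewrite lee_fin.
    by move=> h j; apply: le_trans h; exact: le_bigmax.
  by move=> h; apply: bigmax_le.
apply: le_trans (union_tail mabs tail).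
rewrite lee_fin lerB// /u opprD expRD (expRN (ln _)) lnK ?posrE ?ltr0n//.
rewrite mulrCA [leRHS]mulrC; apply: ler_wpM2l; first exact: expR_ge0.
apply: (@le_trans _ _ 1); last by rewrite ler1n.
by rewrite ler_pdivrMr ?ltr0n// mul1r ler_nat.
Qed.
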